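(* Let $n\ge2$, let $F_1,\dots,F_n:\mathbf R\to[0,1]$ be one-dimensional cdf's, and let $V_1,\dots,V_n$ be independent random variables uniformly distributed on $[0,1]$. A function $F:\mathbf R^n\to[0,1]$ is a joint cdf with one-dimensional marginal cdf's $F_k(x_k)$, $x_k\in\mathbf R$, $k=1,\dots,n$, absolutely continuous with respect to the product of marginal cdf's $\prod_{k=1}^nF_k(x_k)$, if and only if there exist Borel measurable functions $\tilde g_{i_1,\dots,i_c}:[0,1]^c\to\mathbf R$, $1\le i_1<\dots<i_c\le n$, $c=2,\dots,n$, satisfying the conditions (A4) $\int_0^1\cdots\int_0^1|\tilde g_{i_1,\dots,i_c}(t_{i_1},\dots,t_{i_c})|\,dt_{i_1}\cdots dt_{i_c}<\infty$ for all $1\le i_1<\dots<i_c\le n$, $c=2,\dots,n$; (A5) for all $1\le i_1<\dots<i_c\le n$, $c=2,\dots,n$, and $k=1,\dots,c$, $$E\big(\tilde g_{i_1,\dots,i_c}(V_{i_1},\dots,V_{i_c})\,\big|\,V_{i_1},\dots,V_{i_{k-1}},V_{i_{k+1}},\dots,V_{i_c}\big)=\int_0^1\tilde g_{i_1,\dots,i_c}(V_{i_1},\dots,V_{i_{k-1}},t_{i_k},V_{i_{k+1}},\dots,V_{i_c})\,dt_{i_k}=0\quad\text{(a.s.)};$$ (A6) $\tilde U_n(V_1,\dots,V_n)\ge-1$ (a.s.), where $\tilde U_n(t_1,\dots,t_n)=\sum_{c=2}^n\sum_{1\le i_1<\dots<i_c\le n}\tilde g_{i_1,\dots,i_c}(t_{i_1},\dots,t_{i_c})$;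 and such that the following representation holds for $F$: $$F(x_1,\dots,x_n)=\int_0^{F_1(x_1)}\cdots\int_0^{F_n(x_n)}\big(1+\tilde U_n(t_1,\dots,t_n)\big)\prod_{i=1}^ndt_i,$$ or, equivalently, if and only if (with functions $\tilde g_{i_1,\dots,i_c}$ satisfying (A4)–(A6)) the element of joint frequency $dF$ can be expressed in the form $$dF(x_1,\dots,x_n)=\prod_{i=1}^ndF_i(x_i)\big(1+\tilde U_n(F_1(x_1),\dots,F_n(x_n))\big).$$
   Context: Cdf's are taken right-continuous. A joint cdf $F$ on $\mathbf R^n$ with one-dimensional marginals $F_1,\dots,F_n$ is called absolutely continuous with respect to the product of the marginal cdf's if there is a Borel function $G:\mathbf R^n\to[0,\infty)$ with $F(x_1,\dots,x_n)=\int_{-\infty}^{x_1}\cdots\int_{-\infty}^{x_n}G(t_1,\dots,t_n)\,dF_1(t_1)\cdots dF_n(t_n)$ for all $x_1,\dots,x_n$. The expression $dF(x_1,\dots,x_n)=\prod_{i=1}^ndF_i(x_i)\,(1+u(x_1,\dots,x_n))$ means that this holds with $G=1+u$.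
   Formalization: In the second equivalence (the dF form) it is additionally required that F has marginals F_1,...,F_n, unless all F_i are continuous; without this the ''if'' part fails when some F_i has an atom, since the g's are constrained only up to null sets. *)

(* Defs.v *)
From HB Require Import structures.
From mathcomp Require Import all_boot all_order all_algebra.
From mathcomp Require Import all_classical all_reals all_analysis.
From mathcomp Require Import measurable_realfun.

Set Implicit Arguments.
Unset Strict Implicit.
Unset Printing Implicit Defensive.

Import Order.TTheory GRing.Theory Num.Theory.
Import numFieldNormedType.Exports.

Local Open Scope classical_set_scope.
Local Open Scope ring_scope.

(** R^n is [n.-tuple R] with its Borel (product) sigma-algebra; indices run
    over ['I_n], that is, from 0 to n - 1. *)

Definition upd (R : Type) (n : nat) (k : 'I_n) (s : R) (x : n.-tuple R) :
    n.-tuple R :=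
  [tuple (if j == k then s else tnth x j) | j < n].

(* Subvector (x_(i_1), ..., x_(i_c)) for S = {i_1 < ... < i_c}: [enum_val]
   lists the elements of a set of ordinals in increasing order. *)
Definition subtuple (R : Type) (n : nat) (S : {set 'I_n}) (x : n.-tuple R) :
    #|S|.-tuple R :=
  [tuple tnth x (@enum_val _ (mem S) k) | k < #|S|].

(** Iterated integral
    [\int[mu 0]_(t_0 in D 0) ... \int[mu (n-1)]_(t_(n-1) in D (n-1)) f t],
    the first variable being the outermost one. *)
Fixpoint iterated_integral (R : realType) (n : nat) :
    ('I_n -> {measure set (measurableTypeR R) -> \bar R}) ->
    ('I_n -> set R) -> (n.-tuple R -> \bar R) -> \bar R :=
  match n with
  | 0 => fun _ _ f => f [tuple]
  | m.+1 => fun mu D f =>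
      (\int[mu ord0]_(t in D ord0)
         iterated_integral (fun i => mu (lift ord0 i))
                           (fun i => D (lift ord0 i))
                           (fun s => f [tuple of t :: s]))%E
  end.

Section cdfs.
Variables (R : realType) (n : nat).
Implicit Types (F : n.-tuple R -> R) (Fm : 'I_n -> cumulativeBounded (0 : R) 1).

Definition joint_cdf F : Prop :=
  exists Q : probability (n.-tuple R) R,
    forall x, (F x)%:E = Q [set y | forall i, tnth y i <= tnth x i].

Definition has_marginals F Fm : Prop :=
  forall (k : 'I_n) (s : R),
    F (upd k s [tuple m | _ < n]) @[m --> +oo] --> Fm k s.

(** [dF(x) = \prod_i dF_i(x_i) G(x)] with [G : R^n -> [0, oo[]. *)
Definition has_density F Fm (G : n.-tuple R -> R) : Prop :=
  [/\ measurable_fun setT G,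
      forall x, 0 <= G x &
      forall x, ((F x)%:E =
        iterated_integral (fun i => lebesgue_stieltjes_measure (Fm i))
          (fun i => [set` `]-oo, tnth x i]]) (fun t => (G t)%:E))%E].

Definition abs_cont_marginals F Fm : Prop := exists G, has_density F Fm G.

End cdfs.

Section random_variables.
Variables (R : realType) (d : measure_display) (T : measurableType d).
Variables (P : probability T R) (n : nat) (V : 'I_n -> {RV P >-> R}).

(* Subfamilies are covered by taking [A i = setT]. *)
Definition mutually_independent : Prop :=
  forall A : 'I_n -> set R, (forall i, measurable (A i)) ->
    (P [set w | forall i, A i (V i w)] =
     \big[*%E/1%E]_(i < n) P (V i @^-1` A i))%E.

Definition uniform01 (X : {RV P >-> R}) : Prop :=
  forall A, measurable A ->
    distribution P X A = uniform_prob (@ltr01 R) A.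

(** sigma(V_j, j in J) *)
Definition sigma_family (J : {set 'I_n}) : set (set T) :=
  <<s [set B | exists2 j, j \in J &
         exists2 A : set R, measurable A & B = V j @^-1` A] >>.

(** [Z] is a version of [E(X | V_j, j in J)]. *)
Definition is_cond_expectation (X : T -> R) (J : {set 'I_n})
    (Z : T -> \bar R) : Prop :=
  [/\ P.-integrable setT (EFin \o X),
      P.-integrable setT Z,
      forall B : set (\bar R), measurable B -> sigma_family J (Z @^-1` B) &
      forall A, sigma_family J A ->
        (\int[P]_(w in A) Z w = \int[P]_(w in A) (X w)%:E)%E].

Definition rv_tuple (w : T) : n.-tuple R := [tuple V i w | i < n].

End random_variables.

Section canonical_functions.
Variables (R : realType) (n : nat).

(** The families g_(i_1,...,i_c), 1 <= i_1 < ... < i_c <= n, are indexed by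
    S = {i_1 < ... < i_c}. A function on [0,1]^c is represented by one on R^c:
    the values outside the cube never matter, since the V_i are almost surely
    in [0,1] and the cdf's take values in [0,1]; similarly the values of [g S]
    for #|S| < 2 are never used. *)
Definition kernels := forall S : {set 'I_n}, #|S|.-tuple R -> R.

Implicit Type g : kernels.

Definition U g (t : n.-tuple R) : R :=
  \sum_(2 <= c < n.+1) \sum_(S : {set 'I_n} | #|S| == c) g S (subtuple S t).

Definition borel g : Prop :=
  forall S : {set 'I_n}, (2 <= #|S|)%N -> measurable_fun setT (g S).

Definition condA4 g : Prop :=
  forall S : {set 'I_n}, (2 <= #|S|)%N ->
    (iterated_integral (fun=> @lebesgue_measure R) (fun=> `[0%R, 1%R]%classic)
       (fun t => `|g S t|%:E) < +oo)%E.

Variables (d : measure_display) (T : measurableType d).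
Variables (P : probability T R) (V : 'I_n -> {RV P >-> R}).

Definition condA5 g : Prop :=
  forall S : {set 'I_n}, (2 <= #|S|)%N -> forall k, k \in S ->
    let h w := (\int[@lebesgue_measure R]_(t in `[0%R, 1%R])
                  (g S (subtuple S (upd k t (rv_tuple V w))))%:E)%E in
    is_cond_expectation V (fun w => g S (subtuple S (rv_tuple V w)))
      (S :\ k)%SET h /\
    {ae P, forall w, h w = 0%E}.

Definition condA6 g : Prop := {ae P, forall w, -1 <= U g (rv_tuple V w)}.

Definition admissible g : Prop :=
  [/\ borel g, condA4 g, condA5 g & condA6 g].

Definition copula_representation (F : n.-tuple R -> R)
    (Fm : 'I_n -> cumulativeBounded (0 : R) 1) g : Prop :=
  forall x, ((F x)%:E =
    iterated_integral (fun=> @lebesgue_measure R)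
      (fun i => `[0%R, Fm i (tnth x i)]%classic)
      (fun t => (1 + U g t)%:E))%E.

(** [dF(x) = \prod_i dF_i(x_i) (1 + U g (F_1(x_1), ..., F_n(x_n)))].
    Writing dF in terms of the dF_i presupposes that F has marginals F_i. The
    formula does not imply it when the F_i have atoms: admissibility constrains
    [g] only up to Lebesgue-null sets, whereas x |-> (F_1(x_1), ..., F_n(x_n))
    may take values in a null set with positive probability. E.g., for n = 2
    and F_1 = F_2 the cdf of a fair coin, take [g] = 0 except for the values
    1/2 at (1/2, 1/2) and -1/2 at (1, 1/2): it is admissible, but the formula
    yields a joint cdf whose first marginal at 0 is 3/8 + 1/4 = 5/8, not 1/2. *)
Definition density_representation (F : n.-tuple R -> R)
    (Fm : 'I_n -> cumulativeBounded (0 : R) 1) g : Prop :=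
  has_density F Fm (fun x => 1 + U g [tuple Fm i (tnth x i) | i < n]).

End canonical_functions.

(* Main.v *)
Require Import Defs.
From HB Require Import structures.
From mathcomp Require Import all_boot all_order all_algebra.
From mathcomp Require Import all_classical all_reals all_analysis.
From mathcomp Require Import measurable_realfun.
Set Implicit Arguments.
Unset Strict Implicit.
Unset Printing Implicit Defensive.
Import Order.TTheory GRing.Theory Num.Theory.
Import numFieldNormedType.Exports.
Local Open Scope classical_set_scope.
Local Open Scope ring_scope.

(** The quantile functions [Q_i] of the margins carry the uniform law on the cube
    to the product of the margins, and the orthant below [x] corresponds, up to
    a null set, to the box [[0, F_1(x_1)] x ... x [0, F_n(x_n)]]. So a density [G]
    of [F] with respect to the product of the margins yields the copula density
    [c = G \o Q], and [F x] is the integral of [c] over the box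
    ([density_copula]). Since [F] has the margins [F_i], the one-dimensional
    marginal densities of [c] are 1 almost everywhere ([density_avg1]).

    The kernels are those of the Hoeffding decomposition of [c]: with [e_A] the
    average of [c] over the coordinates outside [A], the kernel of [S] is the
    alternating sum of [e_A - 1] over the subsets [A] of [S] with at least two
    elements. By Moebius inversion the kernels add up to [c - 1] at every point
    ([U_hoeffding]), and averaging the kernel of [S] over a coordinate [k] in [S]
    makes the terms of [A] and [k |: A] cancel ([hoeffding_centered]), which is
    the vanishing of the conditional expectations ([centered_cond_expectation]).
    The same kernels give the density with respect to the margins, because
    [Q_i (F_i (Q_i t)) = Q_i t] ([quantileK]): substituting [F_i] into [c] gives
    back [G] almost everywhere, and as the decomposition holds at every point, no
    harm is done by the fact that the values of the [F_i] may form a null set.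

    Conversely, let [1 + U] come from admissible kernels. Every kernel has at
    least two arguments, hence one besides the [k]-th, and centering in it makes
    the kernel integrate to zero over events that involve only the [k]-th
    coordinate. So [1 + U] is the density of a law on the cube with uniform
    marginals ([integral_admissible]). Its image under the quantile
    functions has distribution function [F] and margins [F_i], and it is
    dominated by the product of the margins, so that the Radon-Nikodym theorem
    provides the density ([copula_density_abs_cont]). If the margins are
    continuous, then [F_i (Q_i t) = t] and the density representation reduces to
    the copula representation.

    The calculus of averages over sets of coordinates rests on one observation
    ([mix_law]): exchanging a set of coordinates between two independent copies
    of a vector with independent components does not change the law. *)

(** * Image measures *)

Definition law d d' (T : measurableType d) (T' : measurableType d')
    (R : realType) (P : probability T R) (f : T -> T')
    (mf : measurable_fun setT f) : probability T' R :=
  distribution P (HB.pack_for {mfun T >-> T'} f (isMeasurableFun.Build _ _ _ _ f mf)).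

Section law.
Context d d' (T : measurableType d) (T' : measurableType d') (R : realType).
Variables (P : probability T R) (f : T -> T') (mf : measurable_fun setT f).

Lemma lawE A : law P mf A = P (f @^-1` A).
Proof. by []. Qed.

Lemma ge0_integral_law (g : T' -> \bar R) D : measurable D ->
  measurable_fun setT g -> (forall y, 0 <= g y)%E ->
  (\int[law P mf]_(y in D) g y = \int[P]_(x in f @^-1` D) g (f x))%E.
Proof.
move=> mD mg g0; rewrite -(@ge0_integral_pushforward _ _ _ _ _ _ mf)//.
exact: measurable_funTS.
Qed.

Lemma integral_law (g : T' -> \bar R) : measurable_fun setT g ->
  (\int[law P mf]_y g y = \int[P]_x g (f x))%E.
Proof.
move=> mg; rewrite integralE [RHS]integralE; congr (_ - _)%E.
  rewrite ge0_integral_law//; last exact: measurable_funepos.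
  by apply: eq_integral => x _; rewrite -[LHS]/((_ \o f) x) -funepos_comp.
rewrite ge0_integral_law//; last exact: measurable_funeneg.
by apply: eq_integral => x _; rewrite -[LHS]/((_ \o f) x) -funeneg_comp.
Qed.

Lemma integrable_law (g : T' -> \bar R) : measurable_fun setT g ->
  P.-integrable setT (g \o f) <-> (law P mf).-integrable setT g.
Proof.
move=> mg; have mgf : measurable_fun setT (g \o f) by exact: measurableT_comp.
split=> /integrableP[_ h]; apply/integrableP; split => //.
  by rewrite ge0_integral_law//; exact: measurableT_comp.
by move: h; rewrite ge0_integral_law//; exact: measurableT_comp.
Qed.

Lemma ae_law (p : T' -> Prop) : measurable [set y | p y] ->
  {ae P, forall x, p (f x)} -> {ae law P mf, forall y, p y}.
Proof.
move=> mp; have mNp : measurable (~` [set y | p y]) by exact: measurableC.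
have mNpf : measurable (f @^-1` (~` [set y | p y])).
  by rewrite -[X in measurable X]setTI; exact: mf.
rewrite /almost_everywhere /= => /negligibleP h.
by apply/negligibleP => //; exact: h.
Qed.

Lemma ae_law_pre (p : T' -> Prop) :
  {ae law P mf, forall y, p y} -> {ae P, forall x, p (f x)}.
Proof.
move=> [N [mN N0 Np]]; exists (f @^-1` N); split => //.
  rewrite -[X in measurable X]setTI; exact (mf measurableT mN).
by move=> x /= px; apply: Np.
Qed.

End law.

Lemma eq_ae d (T : measurableType d) (R : realType)
    (m1 m2 : {measure set T -> \bar R}) (p : T -> Prop) :
  (forall A, measurable A -> m1 A = m2 A) ->
  {ae m1, forall x, p x} -> {ae m2, forall x, p x}.
Proof. by move=> m12 [N [mN N0 Np]]; exists N; split => //; rewrite -m12. Qed.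

(** * Rectangles and product probabilities on tuples *)

Section rectangles.
Context (R : realType) (n : nat).
Implicit Types (A : 'I_n -> set R) (L : probability (n.-tuple R) R).

Definition rect A : set (n.-tuple R) := [set x | forall i, A i (tnth x i)].

Lemma measurable_rect A : (forall i, measurable (A i)) -> measurable (rect A).
Proof.
move=> mA; rewrite (_ : rect A =
    \bigcap_(i in [set: 'I_n]) ((@tnth n R)^~ i @^-1` A i)); last first.
  apply/seteqP; split => x /= h i; [move=> _|]; exact: h.
apply: fin_bigcap_measurable => // i _.
by rewrite -[X in measurable X]setTI; apply: measurable_tnth.
Qed.

Lemma measurable_tuple (d : measure_display) (T : measurableType d)
    (f : 'I_n -> T -> R) :
  (forall i, measurable_fun setT (f i)) ->
  measurable_fun setT (fun x => [tuple f i x | i < n]).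
Proof.
move=> mf; apply/measurable_fun_tnthP => i.
rewrite (_ : _ \o _ = f i)//.
by apply/funext => x /=; rewrite tnth_mktuple.
Qed.

(** The rectangles form a pi-system that generates the product sigma-algebra. *)
Lemma rect_unique (L1 L2 : probability (n.-tuple R) R) :
  (forall A, (forall i, measurable (A i)) -> L1 (rect A) = L2 (rect A)) ->
  forall B, measurable B -> L1 B = L2 B.
Proof.
move=> L12; apply: (@measure_unique _ _ _
   [set B | exists2 A, (forall i, measurable (A i)) & B = rect A] (fun=> setT)).
- rewrite eqEsubset; split.
    apply: smallest_sub; first exact: smallest_sigma_algebra.
    rewrite -bigcup_seq/=; apply: bigcup_sub => i _.
    move=> A [B mB <-]; apply: sub_sigma_algebra.
    exists (fun j => if j == i then B else setT).
      by move=> j; case: ifP.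
    rewrite setTI; apply/seteqP; split => x /=.
      by move=> Bx j; case: ifPn => // /eqP ->.
    by move/(_ i); rewrite eqxx.
  apply: smallest_sub; first exact: sigma_algebra_measurable.
  by move=> _ [A mA ->]; exact: measurable_rect.
- move=> _ _ [A mA ->] [B mB ->]; exists (fun i => A i `&` B i).
    by move=> i; exact: measurableI.
  by apply/seteqP; split => x /= => [[hA hB] i|h]; [split|split => i; case: (h i)].
- by move=> _; exists (fun=> setT) => //; apply/seteqP; split.
- by apply/seteqP; split => // x _; exists 0%N.
- by move=> _ [A mA ->]; exact: L12.
- by move=> _; rewrite -ge0_fin_numE //; exact: fin_num_measure.
Qed.

End rectangles.

Section mix.
Context (R : realType) (n : nat).
Implicit Types (A B : {set 'I_n}) (x y : n.-tuple R).

Definition mix A x y : n.-tuple R :=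
  [tuple if i \in A then tnth x i else tnth y i | i < n].

Lemma tnth_mix A x y i :
  tnth (mix A x y) i = if i \in A then tnth x i else tnth y i.
Proof. by rewrite tnth_mktuple. Qed.

Lemma mix_mix A B x y z :
  mix B (mix A x y) z = mix (A :&: B)%SET x (mix B y z).
Proof.
apply/eq_from_tnth => i; rewrite !tnth_mix inE.
by case: (i \in A); case: (i \in B).
Qed.

Lemma mixT x y : mix [set: 'I_n] x y = x.
Proof. by apply/eq_from_tnth => i; rewrite tnth_mix inE. Qed.

Lemma measurable_mix A : measurable_fun setT (fun z => mix A z.1 z.2).
Proof.
apply: measurable_tuple => i; case: (i \in A).
  exact: (measurableT_comp (measurable_tnth i) measurable_fst).
exact: (measurableT_comp (measurable_tnth i) measurable_snd).
Qed.

(** Changing the [k]-th coordinate is exchanging it with that of another point;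
    this turns integrals over one coordinate into integrals over the whole
    space. *)
Lemma upd_mix k s x y : tnth y k = s -> upd k s x = mix [set~ k]%SET x y.
Proof.
move=> <-; apply/eq_from_tnth => i; rewrite tnth_mix tnth_mktuple !inE.
by case: eqP => //= ->.
Qed.

End mix.

Section product_probability.
Context (R : realType) (n : nat) (L : probability (n.-tuple R) R)
  (nu : 'I_n -> probability (measurableTypeR R) R).

Definition is_product := forall A, (forall i, measurable (A i)) ->
  L (rect A) = (\big[*%E/1]_(i < n) nu i (A i))%E.

Hypothesis L_prod : is_product.

(** Exchanging some coordinates between two independent copies of a vector with
    independent components preserves its law. This is the only form of Fubini's
    theorem on tuples that the averaging operators below rely on. *)
Lemma mix_law (A : {set 'I_n}) B : measurable B ->
  law (L \x L)%E (measurable_mix A) B = L B.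
Proof.
apply: rect_unique => C mC; rewrite lawE.
rewrite (_ : _ @^-1` _ = rect (fun i => if i \in A then C i else setT) `*`
                         rect (fun i => if i \in A then setT else C i)).
  transitivity (L (rect (fun i => if i \in A then C i else setT)) *
                L (rect (fun i => if i \in A then setT else C i)))%E.
    by apply: product_measure1E; apply: measurable_rect => i; case: ifP.
  rewrite !L_prod -?big_split//=; [|by move=> i; case: ifP..].
  by apply: eq_bigr => i _; case: ifP; rewrite probability_setT ?mule1 ?mul1e.
apply/seteqP; split => -[x y] /=.
  move=> h; split => i /=; move: (h i); rewrite tnth_mix; case: ifP => //.
by move=> [h1 h2] i; move: (h1 i) (h2 i); rewrite tnth_mix; case: ifP.
Qed.

Lemma integral_mix (A : {set 'I_n}) f : measurable_fun setT f ->
  (\int[(L \x L)%E]_z f (mix A z.1 z.2) = \int[L]_x f x)%E.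
Proof.
move=> mf; rewrite -(integral_law _ (measurable_mix A))//.
by apply: eq_measure_integral => B mB _; exact: mix_law.
Qed.

End product_probability.

(** Tonelli's theorem, applied to the positive and to the negative part. *)
Lemma measurable_partial_integral d d' (T : measurableType d)
    (T' : measurableType d') (R : realType)
    (m : {sigma_finite_measure set T' -> \bar R}) (f : T * T' -> \bar R) :
  measurable_fun setT f -> measurable_fun setT (fun x => \int[m]_y f (x, y))%E.
Proof.
move=> mf; rewrite (_ : (fun _ => _) = (fun x =>
    (\int[m]_y f^\+ (x, y))%E - (\int[m]_y f^\- (x, y))%E)%E); last first.
  apply/funext => x; rewrite integralE; congr (_ - _)%E.
    by apply: eq_integral => y _; rewrite -[RHS]/((_ \o pair x) y) -funepos_comp.
  by apply: eq_integral => y _; rewrite -[RHS]/((_ \o pair x) y) -funeneg_comp.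
apply: emeasurable_funB; apply: measurable_fun_fubini_tonelli_F => //.
  exact: measurable_funepos.
exact: measurable_funeneg.
Qed.

(** * Averaging out coordinates *)

Section averaging.
Context (R : realType) (n : nat) (L : probability (n.-tuple R) R)
  (nu : 'I_n -> probability (measurableTypeR R) R).
Hypothesis L_prod : is_product L nu.
Implicit Types (A B : {set 'I_n}) (f : n.-tuple R -> \bar R) (x y : n.-tuple R).
Local Open Scope ereal_scope.

(** [avg A f] integrates out the coordinates outside [A]: it is the version of
    the conditional expectation of [f] given the coordinates in [A] that a
    product measure provides. *)
Definition avg A f x := \int[L]_y f (mix A x y).

Lemma measurable_mixx A x : measurable_fun setT (mix A x).
Proof.
have h : measurable_fun setT (fun y => (x, y)).
  exact: measurable_fun_pair.
exact: (measurableT_comp (@measurable_mix R n A) h).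
Qed.

Lemma measurable_avg A f : measurable_fun setT f -> measurable_fun setT (avg A f).
Proof.
move=> mf.
apply: (@measurable_partial_integral _ _ _ _ _ L (fun z => f (mix A z.1 z.2))).
exact: (measurableT_comp mf (@measurable_mix R n A)).
Qed.

Lemma avg_ge0 A f x : (forall y, 0 <= f y) -> 0 <= avg A f x.
Proof. by move=> f0; exact: integral_ge0. Qed.

Lemma integral_avg A f : measurable_fun setT f -> (forall y, 0 <= f y) ->
  \int[L]_x avg A f x = \int[L]_x f x.
Proof.
move=> mf f0; rewrite -[RHS](integral_mix L_prod A)//; apply/esym.
apply: (@fubini_tonelli1 _ _ _ _ _ L L (fun z => f (mix A z.1 z.2))) => //.
exact: (measurableT_comp mf (@measurable_mix R n A)).
Qed.

Lemma avgT f x : avg [set: 'I_n]%SET f x = f x.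
Proof.
rewrite /avg; under eq_integral do rewrite mixT.
by rewrite integral_cst//= probability_setT mule1.
Qed.

(** The tower property, here with two arbitrary sets of coordinates because the
    coordinates are independent. *)
Lemma avg_avg A B f x : measurable_fun setT f -> (forall y, 0 <= f y) ->
  avg A (avg B f) x = avg (A :&: B)%SET f x.
Proof.
move=> mf f0; rewrite /avg.
under eq_integral do under eq_integral do rewrite mix_mix.
have mh : measurable_fun setT (f \o mix (A :&: B)%SET x).
  exact: (measurableT_comp mf (@measurable_mixx _ _)).
exact: (integral_avg B mh (fun y => f0 _)).
Qed.

Lemma integrable_mix A f : L.-integrable setT f ->
  (L \x L).-integrable setT (fun z => f (mix A z.1 z.2)).
Proof.
move=> fi; have mf := measurable_int _ fi.
apply/(integrable_law (L \x L)%E (measurable_mix A)) => //.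
move/integrableP : fi => [_ fi]; apply/integrableP; split => //.
apply: le_lt_trans fi; rewrite (@eq_measure_integral _ _ _ _ L)//.
by move=> C mC _; exact: (mix_law L_prod A).
Qed.

Lemma ae_integrable_mix A f : L.-integrable setT f ->
  {ae L, forall x, L.-integrable setT (f \o mix A x)}.
Proof.
move=> fi.
exact: (@ae_integrable1 _ _ _ _ _ L L _ (integrable_mix A fi)).
Qed.

(** A function that averages to zero over the [k]-th coordinate is orthogonal
    to the events that do not involve this coordinate. *)
Lemma centered_integral0 k f (B : set (n.-tuple R)) : measurable B ->
  L.-integrable setT f ->
  {ae L, forall x, avg [set~ k]%SET f x = 0} ->
  (forall x y, B (mix [set~ k]%SET x y) <-> B x) ->
  \int[L]_(x in B) f x = 0.
Proof.
move=> mB fi f0 Bk; have mf := measurable_int _ fi.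
rewrite integral_mkcond.
have fBi : L.-integrable setT (f \_ B).
  apply/(integrable_mkcond _ mB); apply: integrableS fi => //.
have mfB := measurable_int _ fBi.
(* B does not involve the k-th coordinate, so averaging f restricted to B over it
   gives the restriction to B of the average of f, which vanishes *)
rewrite -(integral_mix L_prod [set~ k]%SET)//.
have gi := integrable_mix [set~ k]%SET fBi.
rewrite -(integral12_prod_meas1 gi).
rewrite (ae_eq_integral (cst 0))//; first by rewrite integral0.
  exact: (measurable_fubini_F gi).
move: f0; apply: filterS => x fx0 _; rewrite /fubini_F.
have [xB|xB] := pselect (B x); last first.
  rewrite integral0_eq//= => y _.
  rewrite patchE memNset//.
  by move/(Bk x y).
rewrite -[RHS]fx0; apply: eq_integral => y _.
by rewrite patchE/= mem_set//; apply/Bk.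
Qed.

End averaging.

(** * Alternating sums over subsets *)

Section subset_sums.
Context (R : comPzRingType) (T : finType).
Implicit Types (S A : {set T}) (h : {set T} -> R).

Lemma sum_set_split k h :
  \sum_S h S = \sum_(S : {set T} | k \notin S) (h S + h (k |: S)%SET).
Proof.
rewrite (bigID (fun S => k \notin S))/= big_split/=; congr (_ + _).
rewrite (reindex_onto (fun S => k |: S)%SET (fun S => S :\ k)%SET)/=.
  apply: eq_bigl => S; rewrite negbK finset.setU11/=; apply/eqP/idP => [<-|kS].
    by rewrite !inE eqxx.
  by rewrite finset.setU1K.
by move=> S; rewrite negbK => kS; rewrite finset.setD1K.
Qed.

Definition alternating_sum h S :=
  \sum_(A : {set T} | A \subset S) (-1) ^+ #|S :\: A|%SET * h A.

(** The sign changes when [k] joins [A], so the sum only depends on differences of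
    values at [A] and [k |: A]. *)
Lemma alternating_sum_split h S k : k \in S ->
  alternating_sum h S =
  \sum_(A : {set T} | (A \subset S) && (k \notin A))
    (-1) ^+ #|S :\: A|%SET * (h A - h (k |: A)%SET).
Proof.
move=> kS; rewrite /alternating_sum big_mkcond (sum_set_split k)/=.
rewrite [RHS]big_mkcondl/=; apply: eq_bigr => A kA.
rewrite finset.subUset finset.sub1set kS/=; case: ifP => // AS; last by rewrite addr0.
rewrite mulrBr; congr (_ + _).
rewrite (_ : (S :\: A)%SET = k |: (S :\: (k |: A)))%SET; last first.
  apply/finset.setP => i; rewrite !inE; case: eqP => //= ->.
  by rewrite kS kA.
by rewrite cardsU1 !inE eqxx/= add1n exprS mulN1r mulNr opprK.
Qed.

(** Moebius inversion on the lattice of subsets: the terms with [A] not full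
    cancel in pairs [S], [k |: S] for any [k] outside [A]. *)
Lemma sum_alternating_sum h : \sum_S alternating_sum h S = h [set: T]%SET.
Proof.
rewrite /alternating_sum; under eq_bigr do rewrite big_mkcond.
rewrite exchange_big/= (bigD1 [set: T]%SET)//= [X in _ + X]big1 ?addr0.
  rewrite (bigD1 [set: T]%SET)//= big1 ?addr0.
    by rewrite finset.subsetT finset.setDT cards0 mul1r.
  by move=> S /negbTE; rewrite finset.subTset => ->.
move=> A; rewrite -finset.subTset => /subsetPn[k _ kA].
rewrite (sum_set_split k) big1// => S kS.
have -> : (A \subset (k |: S)%SET) = (A \subset S).
  apply/idP/idP => [/fintype.subsetP AS|AS]; last first.
    exact: (fintype.subset_trans AS (finset.subsetUr _ _)).
  apply/fintype.subsetP => i iA; have := AS i iA; rewrite !inE => /orP[/eqP ik|//].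
  by move: kA; rewrite -ik iA.
case: ifP => [AS|]; last by rewrite addr0.
rewrite (_ : ((k |: S) :\: A)%SET = k |: (S :\: A))%SET; last first.
  by apply/finset.setP => i; rewrite !inE; case: eqP => //= ->; rewrite kA.
rewrite cardsU1 !inE (negbTE kS) andbF/= add1n exprS mulN1r mulNr.
by rewrite subrr.
Qed.

End subset_sums.

Lemma integral_alternating_sum (R : realType) (I : finType) d (T : measurableType d)
    (mu : {measure set T -> \bar R}) (f : {set I} -> T -> R) (v : {set I} -> R)
    (S : {set I}) :
  (forall A, mu.-integrable setT (EFin \o f A)) ->
  (forall A, \int[mu]_t (f A t)%:E = (v A)%:E)%E ->
  mu.-integrable setT (fun t => (alternating_sum (f ^~ t) S)%:E) /\
  (\int[mu]_t (alternating_sum (f ^~ t) S)%:E = (alternating_sum v S)%:E)%E.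
Proof.
move=> fi fv; pose s (A : {set I}) : R := (-1) ^+ #|S :\: A|%SET.
have E : (fun t => (alternating_sum (f ^~ t) S)%:E) =
    (fun t => \sum_(A : {set I} | A \subset S) (s A)%:E * (f A t)%:E)%E.
  by apply/funext => t; rewrite -sumEFin.
have si A : mu.-integrable setT (fun t => (s A)%:E * (f A t)%:E)%E.
  exact: (integrableZl _ _ (fi A)).
rewrite E; split; first by apply: integrable_sum => // A _; exact: si.
rewrite integral_sum//.
rewrite -sumEFin; apply: eq_bigr => A _.
by rewrite (integralZl _ (fi A))// fv.
Qed.

(** * The Hoeffding decomposition *)

Section embedding.
Context (R : realType) (n : nat).
Implicit Types (S A : {set 'I_n}) (x y : n.-tuple R).

(** A right inverse of [subtuple S], padding with zeros. *)
Definition ext S (z : #|S|.-tuple R) : n.-tuple R :=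
  [tuple if [pick k | @enum_val _ (mem S) k == i] is Some k then tnth z k else 0
   | i < n].

Lemma ext_subtuple S x : ext (subtuple S x) = mix S x [tuple 0 | _ < n].
Proof.
apply/eq_from_tnth => i; rewrite tnth_mix !tnth_mktuple.
case: pickP => [k /eqP <-|ik].
  by rewrite tnth_mktuple enum_valP.
case: ifPn => // iS; have := ik (enum_rank_in iS i).
by rewrite enum_rankK_in// eqxx.
Qed.

Lemma measurable_ext S : measurable_fun setT (@ext S).
Proof.
apply: measurable_tuple => i; case: pickP => [k _|_].
  exact: measurable_tnth.
exact: measurable_cst.
Qed.

Lemma measurable_subtuple S : measurable_fun setT (@subtuple R n S).
Proof. by apply: measurable_tuple => i; exact: measurable_tnth. Qed.

Lemma measurable_upd (k : 'I_n) :
  measurable_fun setT (fun z : R * n.-tuple R => upd k z.1 z.2).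
Proof.
apply: measurable_tuple => i; case: eqP => _; first exact: measurable_fst.
exact: (measurableT_comp (measurable_tnth i) measurable_snd).
Qed.

End embedding.

Section hoeffding.
Context (R : realType) (n : nat) (L : probability (n.-tuple R) R)
  (nu : 'I_n -> probability (measurableTypeR R) R).
Hypothesis L_prod : is_product L nu.
Variable c : n.-tuple R -> R.
Implicit Types (S A : {set 'I_n}) (x y : n.-tuple R).

Definition marginal_density A x : R := fine (avg L A (EFin \o c) x).

(** The density of a single coordinate is 1 only almost everywhere; the convention
    for small [A] makes the kernels of small sets vanish identically, so that the
    decomposition holds at every point. *)
Definition excess A x : R := if (2 <= #|A|)%N then marginal_density A x - 1 else 0.

Definition hoeffding : kernels R n := fun S z =>
  alternating_sum (fun A => excess A (ext z)) S.

Hypotheses (mc : measurable_fun setT c) (c0 : forall x, 0 <= c x)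
  (c1 : (\int[L]_x (c x)%:E = 1)%E)
  (cmarg : forall j : 'I_n,
    {ae L, forall x, avg L [set j]%SET (EFin \o c) x = 1%E}).

Let mEc : measurable_fun setT (EFin \o c).
Proof. exact/measurable_EFinP. Qed.

Let Ec0 x : (0 <= (EFin \o c) x)%E.
Proof. by rewrite lee_fin. Qed.

Lemma measurable_marginal_density A : measurable_fun setT (marginal_density A).
Proof.
apply: (measurableT_comp (fine_measurable measurableT)).
exact: measurable_avg.
Qed.

Lemma measurable_excess A : measurable_fun setT (excess A).
Proof.
rewrite /excess; case: (2 <= #|A|)%N => //.
apply: measurable_funB => //; exact: measurable_marginal_density.
Qed.

Lemma excess_local S A x y : A \subset S -> excess A (mix S x y) = excess A x.
Proof.
move=> AS; rewrite /excess /marginal_density /avg.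
congr (if _ then fine _ - 1 else 0); apply: eq_integral => z _.
congr (EFin (c _)); apply/eq_from_tnth => i; rewrite !tnth_mix.
by case: ifP => // iA; have /= -> := fintype.subsetP AS i iA.
Qed.

Lemma hoeffding_subtuple S x :
  hoeffding (subtuple S x) = alternating_sum (fun A => excess A x) S.
Proof.
apply: eq_bigr => A AS; congr (_ * _).
by rewrite ext_subtuple excess_local.
Qed.

Lemma measurable_hoeffding S : measurable_fun setT (@hoeffding S).
Proof.
rewrite (_ : @hoeffding S = fun z => \sum_(A : {set 'I_n} | A \subset S)
    (-1) ^+ #|S :\: A|%SET * excess A (ext z)) //.
under eq_fun do rewrite -big_filter.
apply: measurable_sum => A; apply: measurable_funM => //.
exact: (measurableT_comp (measurable_excess A) (@measurable_ext R n S)).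
Qed.

(** Averaging over no coordinate is the identity, so Moebius inversion recovers
    [c] itself at every point, with no exceptional null set. *)
Lemma sum_hoeffding x : (2 <= n)%N ->
  \sum_S hoeffding (subtuple S x) = c x - 1.
Proof.
move=> n2; under eq_bigr do rewrite hoeffding_subtuple.
by rewrite sum_alternating_sum /excess cardsT card_ord n2 /marginal_density avgT.
Qed.

Lemma hoeffding_small S x : (#|S| < 2)%N -> hoeffding (subtuple S x) = 0.
Proof.
move=> S2; rewrite hoeffding_subtuple /alternating_sum big1// => A AS.
by rewrite /excess leqNgt (leq_ltn_trans (subset_leq_card AS))// mulr0.
Qed.

Lemma integrable_avg A : L.-integrable setT (avg L A (EFin \o c)).
Proof.
apply/integrableP; split; first exact: measurable_avg.
under eq_integral do rewrite gee0_abs ?avg_ge0//.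
by rewrite (integral_avg L_prod)// c1 ltry.
Qed.

Lemma integrable_marginal_density A : L.-integrable setT (EFin \o marginal_density A).
Proof.
apply: le_integrable (integrable_avg A) => //.
  by apply/measurable_EFinP; exact: measurable_marginal_density.
move=> x _ /=; rewrite /marginal_density.
by case: (avg L A _ x) => [r| |] //=; rewrite ?normr0 ?leey.
Qed.

Lemma integrable_excess A : L.-integrable setT (EFin \o excess A).
Proof.
rewrite /excess; case: (2 <= #|A|)%N; last exact: integrable0.
rewrite (_ : EFin \o _ = (EFin \o marginal_density A) \- cst 1)%E//.
apply: integrableB => //; first exact: integrable_marginal_density.
exact: finite_measure_integrable_cst.
Qed.

(** The tower property holds everywhere for the extended-real averages; null sets
    enter only where these are infinite. *)
Lemma avg_marginal_density A B : {ae L, forall x,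
  avg L A (EFin \o marginal_density B) x = (marginal_density (A :&: B)%SET x)%:E}.
Proof.
have := ae_integrable_mix L_prod A (integrable_avg B).
have := integrable_ae measurableT (integrable_avg (A :&: B)%SET).
apply: filterS2 => x /(_ I) finx xi.
rewrite /marginal_density fineK// -(avg_avg L_prod)//.
rewrite [RHS]/avg [LHS]/avg (ae_eq_integral (avg L B (EFin \o c) \o mix A x))//.
- apply/measurable_EFinP.
  exact: (measurableT_comp (measurable_marginal_density B) (measurable_mixx A x)).
- exact: (measurable_int _ xi).
- by move: (integrable_ae measurableT xi); apply: filterS => y /= + _ => /(_ I) /fineK.
Qed.

Lemma avg_excess A B : {ae L, forall x, avg L A (EFin \o excess B) x =
  (if (2 <= #|B|)%N then marginal_density (A :&: B)%SET x - 1 else 0)%:E}.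
Proof.
have := ae_integrable_mix L_prod A (integrable_marginal_density B).
have := avg_marginal_density A B.
apply: filterS2 => x px xi; rewrite /excess /avg; case: (2 <= #|B|)%N; last first.
  by rewrite integral0_eq.
have := @integralB_EFin _ _ _ L setT
  (marginal_density B \o mix A x) (cst 1) measurableT xi.
rewrite /= => ->; last exact: finite_measure_integrable_cst.
rewrite integral_cst//= probability_setT mul1e.
by rewrite EFinB -px.
Qed.

Lemma integrable_hoeffding S :
  L.-integrable setT (fun x => (hoeffding (subtuple S x))%:E).
Proof.
under eq_fun do rewrite hoeffding_subtuple.
apply: (@integral_alternating_sum _ _ _ _ L excess
  (fun A => fine (\int[L]_x (excess A x)%:E)) S _ _).1.
  exact: integrable_excess.
move=> A; rewrite fineK//; apply: (integrable_fin_num _ (integrable_excess A)) => //.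
Qed.

(** For [k] not in [A], averaging over the [k]-th coordinate makes the excesses of
    [A] and [k |: A] equal. For a singleton [A] this uses that the
    one-dimensional marginals of [c] are uniform. *)
Lemma hoeffding_centered S k : k \in S ->
  {ae L, forall x,
    avg L [set~ k]%SET (fun y => (hoeffding (subtuple S y))%:E) x = 0%E}.
Proof.
move=> kS.
have h1 : {ae L, forall x, forall A, avg L [set~ k]%SET (EFin \o excess A) x =
  (if (2 <= #|A|)%N then marginal_density ([set~ k] :&: A)%SET x - 1 else 0)%:E}.
  by apply: filter_forall => A; exact: avg_excess.
have h2 : {ae L, forall x, forall A,
    L.-integrable setT ((EFin \o excess A) \o mix [set~ k]%SET x)}.
  apply: filter_forall => A; apply: (ae_integrable_mix L_prod).
  exact: integrable_excess.
have h3 : {ae L, forall x, forall j, avg L [set j]%SET (EFin \o c) x = 1%E}.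
  exact: filter_forall.
move: h1 h2 h3; apply: filterS3 => x h1 h2 h3.
rewrite /avg; under eq_integral do rewrite hoeffding_subtuple.
have [_ ->] := @integral_alternating_sum _ _ _ _ L
  (fun A => excess A \o mix [set~ k]%SET x)
  (fun A => if (2 <= #|A|)%N then marginal_density ([set~ k] :&: A)%SET x - 1
            else 0) S h2 h1.
rewrite (alternating_sum_split _ kS) big1// => A /andP[_ kA].
have -> : ([set~ k] :&: (k |: A) = A)%SET.
  by apply/finset.setP => i; rewrite !inE; case: eqP => //= ->; rewrite (negbTE kA).
have -> : ([set~ k] :&: A = A)%SET.
  by apply/finset.setP => i; rewrite !inE; case: eqP => //= ->; rewrite (negbTE kA).
rewrite cardsU1 kA add1n ltnS.
have [A1|A1] := leqP 2 #|A|; first by rewrite ltnW// subrr mulr0.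
case: ifPn; last by rewrite subrr mulr0.
move=> A0; have /cards1P[j ->] : #|A| == 1%N by rewrite eqn_leq A0 andbT.
by rewrite /marginal_density h3/= subrr subr0 mulr0.
Qed.

End hoeffding.

Lemma sum_card_ge (R : zmodType) (n m : nat) (F : {set 'I_n} -> R) :
  \sum_(m <= c < n.+1) \sum_(S : {set 'I_n} | #|S| == c) F S =
  \sum_(S : {set 'I_n} | (m <= #|S|)%N) F S.
Proof.
under eq_bigr do rewrite big_mkcond/=.
rewrite exchange_big/= [RHS]big_mkcond/=; apply: eq_bigr => S _.
have Sn : (#|S| < n.+1)%N by rewrite ltnS -[leqRHS]card_ord max_card.
case: ifPn => mS.
  rewrite (bigD1_seq #|S|) ?mem_index_iota ?mS ?iota_uniq//= eqxx big1 ?addr0//.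
  by move=> c; rewrite eq_sym => /negbTE ->.
rewrite big_nat big1// => c /andP[mc _]; case: eqP => // Sc.
by rewrite Sc mc in mS.
Qed.

Lemma UE (R : realType) (n : nat) (g : kernels R n) t :
  U g t = \sum_(S : {set 'I_n} | (2 <= #|S|)%N) g S (subtuple S t).
Proof. exact: sum_card_ge. Qed.

Lemma U_hoeffding (R : realType) (n : nat) (L : probability (n.-tuple R) R)
    (c : n.-tuple R -> R) x : (2 <= n)%N -> 1 + U (hoeffding L c) x = c x.
Proof.
move=> n2; rewrite UE; apply/eqP; rewrite eq_sym addrC -subr_eq; apply/eqP.
rewrite -(sum_hoeffding L c x n2) [LHS](bigID (fun S : {set 'I_n} => 2 <= #|S|)%N)/=.
rewrite [X in _ + X]big1 ?addr0// => S; rewrite -ltnNge.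
exact: hoeffding_small.
Qed.

(** * Product measures and iterated integrals *)

Section product_measure.
Context (R : realType).

Lemma measurable_pair_cons n :
  measurable_fun setT (fun z : measurableTypeR R * n.-tuple R =>
    [tuple of z.1 :: z.2] : n.+1.-tuple R).
Proof. exact: (measurable_cons (@measurable_fst _ _ R (n.-tuple R)) measurable_snd). Qed.

Fixpoint prodm n : ('I_n -> probability (measurableTypeR R) R) ->
    probability (n.-tuple R) R :=
  match n with
  | 0 => fun _ => \d_([tuple] : 0.-tuple R)
  | m.+1 => fun nu =>
      law (nu ord0 \x prodm (fun i => nu (lift ord0 i)))%E (@measurable_pair_cons m)
  end.

Definition unif : probability (measurableTypeR R) R := uniform_prob (@ltr01 R).

Lemma prodm_is_product n (nu : 'I_n -> probability (measurableTypeR R) R) :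
  is_product (prodm nu) nu.
Proof.
elim: n nu => [|n IH] nu A mA.
  rewrite big_ord0 /= diracE mem_set//; by case.
rewrite big_ord_recl -IH//= lawE.
rewrite (_ : _ @^-1` _ = A ord0 `*` rect (fun i => A (lift ord0 i))).
  apply: product_measure1E; first exact: mA.
  by apply: measurable_rect => i; exact: mA.
apply/seteqP; split => -[t s] /=.
  move=> h; split => [|i]; first exact: (h ord0).
  by have := h (lift ord0 i); rewrite tnthS.
move=> [h1 h2] i; have [->//|] := eqVneq i ord0.
by case: (unliftP ord0 i) => [j -> _|->]; [rewrite tnthS; exact: h2|rewrite eqxx].
exact: measurable_id.
Qed.

Lemma ge0_integral_prodmS n (nu : 'I_n.+1 -> probability (measurableTypeR R) R) f :
  measurable_fun setT f -> (forall x, 0 <= f x)%E ->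
  (\int[prodm nu]_x f x =
   \int[nu ord0]_t \int[prodm (fun i => nu (lift ord0 i))]_s f [tuple of t :: s])%E.
Proof.
move=> mf f0; rewrite /= ge0_integral_law//.
apply: (@fubini_tonelli1 _ _ _ _ _ (nu ord0) (prodm (fun i => nu (lift ord0 i)))
  (fun z => f [tuple of z.1 :: z.2])) => //.
exact: (measurableT_comp mf (@measurable_pair_cons n)).
Qed.

Lemma measurable_consl n t :
  measurable_fun setT (fun s : n.-tuple R => [tuple of t :: s] : n.+1.-tuple R).
Proof. exact: measurable_cons. Qed.

Lemma eq_iterated_integral n (mu nu : 'I_n -> {measure set (measurableTypeR R) -> \bar R})
    D f f' :
  (forall i A, measurable A -> A `<=` D i -> mu i A = nu i A) ->
  (forall x, rect D x -> f x = f' x) ->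
  iterated_integral mu D f = iterated_integral nu D f'.
Proof.
elim: n mu nu D f f' => [|n IH] mu nu D f f' munu ff' /=.
  by apply: ff' => -[].
rewrite (eq_measure_integral (nu ord0)); last exact: munu.
apply: eq_integral => t; rewrite inE => Dt; apply: IH => [i A mA AD|s Ds].
  exact: munu.
apply: ff' => i; have [->//|] := eqVneq i ord0.
by case: (unliftP ord0 i) => [j -> _|->]; [rewrite tnthS; exact: Ds|rewrite eqxx].
Qed.

Lemma ge0_iterated_integralE n (nu : 'I_n -> probability (measurableTypeR R) R) D f :
  (forall i, measurable (D i)) -> measurable_fun setT f -> (forall x, 0 <= f x)%E ->
  (iterated_integral nu D f = \int[prodm nu]_(x in rect D) f x)%E.
Proof.
elim: n nu D f => [|n IH] nu D f mD mf f0.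
  have -> : rect D = setT by apply/seteqP; split => // x _ [].
  rewrite [LHS]/= [RHS]/= integral_dirac//.
  by rewrite diracE mem_set ?mul1e.
rewrite [RHS]integral_mkcond ge0_integral_prodmS; last 2 first.
  apply: (measurable_restrictT f (measurable_rect mD)).1.
  exact: measurable_funTS.
  by move=> x; rewrite patchE; case: ifP.
rewrite [LHS]/= [LHS]integral_mkcond; apply: eq_integral => t _.
rewrite patchE; case: ifPn => Dt.
  rewrite IH//; last exact: (measurableT_comp mf (measurable_consl t)).
  rewrite integral_mkcond; apply: eq_integral => s _; rewrite !patchE.
  congr (if _ then _ else _); apply/idP/idP; rewrite !inE => h i.
    have [->|] := eqVneq i ord0; first by move: Dt; rewrite inE.
    by case: (unliftP ord0 i) => [j -> _|->]; [rewrite tnthS; exact: h|rewrite eqxx].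
  by have := h (lift ord0 i); rewrite tnthS.
rewrite integral0_eq// => s _; rewrite patchE memNset// => /(_ ord0)/= h.
by move: Dt; rewrite notin_setE; exact.
Qed.

Lemma measurable_iterated_integral n (nu : 'I_n -> probability (measurableTypeR R) R) D
    d (T : measurableType d) (f : T * n.-tuple R -> \bar R) :
  (forall i, measurable (D i)) -> measurable_fun setT f ->
  measurable_fun setT (fun x => iterated_integral nu D (fun s => f (x, s))).
Proof.
elim: n nu D d T f => [|n IH] nu D d T f mD mf /=.
  by apply: (measurableT_comp mf); exact: measurable_fun_pair.
pose h (z : T * measurableTypeR R) :=
  iterated_integral (fun i => nu (lift ord0 i)) (fun i => D (lift ord0 i))
    (fun s => f (z.1, [tuple of z.2 :: s])).
have mh : measurable_fun setT h.
  apply: (IH _ _ _ _ (fun w => f (w.1.1, [tuple of w.1.2 :: w.2]))) => //.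
  apply: (measurableT_comp mf).
  apply: measurable_fun_pair.
    exact: (measurableT_comp measurable_fst measurable_fst).
  apply: (@measurable_cons _ _ _ R).
    exact: (measurableT_comp measurable_snd measurable_fst).
  exact: measurable_snd.
have mTD : measurable (setT `*` D ord0 : set (T * measurableTypeR R)).
  apply: measurableX; [exact: measurableT|exact: mD].
rewrite (_ : (fun _ => _) = fun x => (\int[nu ord0]_t (h \_ (setT `*` D ord0)) (x, t))%E).
  apply: measurable_partial_integral.
  apply: (measurable_restrictT h mTD).1.
  exact: measurable_funTS.
apply/funext => x; rewrite integral_mkcond; apply: eq_integral => t _.
by rewrite !patchE in_setX in_setT.
Qed.

Lemma ae_prod_section d d' (T : measurableType d) (T' : measurableType d')
    (m1 : {sigma_finite_measure set T -> \bar R})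
    (m2 : {sigma_finite_measure set T' -> \bar R}) (p : T * T' -> Prop) :
  {ae (m1 \x m2)%E, forall z, p z} -> {ae m1, forall x, {ae m2, forall y, p (x, y)}}.
Proof.
move=> [N [mN N0 Np]].
have : (\int[m1]_x `|m2 (xsection N x)| = 0)%E.
  by rewrite -[RHS]N0; apply: eq_integral => x _; rewrite gee0_abs.
move/(ae_eq_integral_abs _ measurableT (measurable_fun_xsection m2 mN)).1.
apply: filterS => x /= /(_ Logic.I) Nx; exists (xsection N x); split => //.
  exact: measurable_xsection.
by move=> y /= pxy; apply/xsectionP; exact: Np.
Qed.

(** Almost every section of a null set is null, so at each level the inner
    integrals agree almost everywhere; that they may be replaced under the outer
    integral rests on their measurability, also for functions of both signs. *)
Lemma ae_eq_iterated_integral n (nu : 'I_n -> probability (measurableTypeR R) R) D f f' :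
  (forall i, measurable (D i)) -> measurable_fun setT f -> measurable_fun setT f' ->
  {ae prodm nu, forall x, f x = f' x} ->
  iterated_integral nu D f = iterated_integral nu D f'.
Proof.
elim: n nu D f f' => [|n IH] nu D f f' mD mf mf' ff'.
  rewrite /=; move: ff' => [N [mN /= N0 Nf]]; apply: contrapT => ff'.
  have /= := Nf [tuple] ff'; rewrite -in_setE => NT.
  by move: N0; rewrite diracE NT => /eqP; rewrite onee_eq0.
rewrite /=; apply: ae_eq_integral => //.
- exact: mD.
- apply: measurable_funTS.
  apply: (@measurable_iterated_integral _ _ _ _ (measurableTypeR R)
    (fun z => f [tuple of z.1 :: z.2])) => //.
  exact: (measurableT_comp mf (@measurable_pair_cons n)).
- apply: measurable_funTS.
  apply: (@measurable_iterated_integral _ _ _ _ (measurableTypeR R)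
    (fun z => f' [tuple of z.1 :: z.2])) => //.
  exact: (measurableT_comp mf' (@measurable_pair_cons n)).
move: ff' => /ae_law_pre /ae_prod_section; apply: filterS => t ht _.
apply: IH => //.
- exact: (measurableT_comp mf (measurable_consl t)).
- exact: (measurableT_comp mf' (measurable_consl t)).
Qed.

End product_measure.

(** * Quantile functions *)

Section quantile.
Context (R : realType) (F : cumulativeBounded (0 : R) 1).

Lemma cumulative_nd x y : x <= y -> F x <= F y.
Proof. exact: cumulative_is_nondecreasing. Qed.

Lemma cumulative_ge0 x : 0 <= F x.
Proof.
apply: (cvgr_to_le (cumulativeNy F)).
by near=> y; apply: cumulative_nd; near: y; exact: nbhs_ninfty_le.
Unshelve. all: by end_near. Qed.

Lemma cumulative_le1 x : F x <= 1.
Proof.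
apply: (cvgr_to_ge (cumulativey F)).
by near=> y; apply: cumulative_nd; near: y; exact: nbhs_pinfty_ge.
Unshelve. all: by end_near. Qed.

(** The endpoint 1 belongs to the domain because [F] takes the value 1 at a largest
    atom, and [quantileK] has to recover this atom. *)
Definition quantile : R -> R := (fun t => inf [set x | t <= F x]) \_ `]0, 1].

(** The Galois connection between a distribution function and its quantile
    function; right-continuity says that the infimum is attained. *)
Lemma quantile_le t x y : 0 < t -> t <= F y -> (quantile t <= x) = (t <= F x).
Proof.
move=> t0 tFy; have t1 : t <= 1 := le_trans tFy (cumulative_le1 y).
rewrite /quantile patchE mem_set/= ?in_itv/= ?t0//.
set E := [set x | t <= F x].
have lE : has_lbound E.
  have [z /= Fzt] : exists z, F z < t.
    near (-oo : set_system R) => z; exists z; near: z.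
    exact: (cvgr_lt _ (cumulativeNy F)).
  exists z => u /= tu; rewrite leNgt; apply/negP => /ltW /cumulative_nd zu.
  by have := lt_le_trans Fzt (le_trans tu zu); rewrite ltxx.
have E0 : E !=set0 by exists y.
apply/idP/idP => [qx|tx]; last exact: ge_inf.
have up z : inf E < z -> t <= F z.
  move=> Ez; have := @inf_adherent _ E (z - inf E) _ (conj E0 lE).
  rewrite subr_gt0 => /(_ Ez)[u /= tu]; rewrite addrC subrK => /ltW /cumulative_nd.
  exact: le_trans.
have := @cumulative_is_right_continuous _ _ _ F x.
move/cvgr_to_ge; apply; near=> z; apply: up; apply: (le_lt_trans qx).
by near: z; exact: nbhs_right_gt.
Unshelve. all: by end_near. Qed.

Lemma quantileP t x : 0 < t < 1 -> (quantile t <= x) = (t <= F x).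
Proof.
move=> /andP[t0 t1].
have [y /= /ltW tFy] : exists y, t < F y.
  near (+oo : set_system R) => y; exists y; near: y.
  exact: (cvgr_gt _ (cumulativey F)).
exact: quantile_le tFy.
Unshelve. all: by end_near. Qed.

Lemma le_cdf_quantile t : 0 < t < 1 -> t <= F (quantile t).
Proof. by move=> t01; rewrite -quantileP. Qed.

(** The distribution function need not be injective, but it is so on the range
    of the quantile function, where almost all of the mass lies. *)
Lemma quantileK t : 0 < t < 1 -> quantile (F (quantile t)) = quantile t.
Proof.
move=> t01; have tq := le_cdf_quantile t01; have /andP[t0 _] := t01.
have Fq0 : 0 < F (quantile t) := lt_le_trans t0 tq.
apply/le_anti; rewrite (@quantile_le _ _ (quantile t))// lexx/=.
by rewrite quantileP// (le_trans tq)// -(@quantile_le _ _ (quantile t)).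
Qed.

(** By minimality of the quantile [F] stays below [t] to the left of it. *)
Lemma cdf_quantile t : continuous (F : R -> R) -> 0 < t < 1 -> F (quantile t) = t.
Proof.
move=> Fc t01; apply/le_anti; rewrite le_cdf_quantile// andbT.
apply: (cvgr_to_le (cvg_at_left_filter (Fc (quantile t)))).
near=> y; apply/ltW; rewrite ltNge -quantileP// -ltNge.
by near: y; exact: nbhs_left_lt.
Unshelve. all: by end_near. Qed.

Lemma measurable_quantile : measurable_fun setT quantile.
Proof.
apply: (measurable_restrictT _ _).1 => //.
apply/measurable_fun_itv_bndo_bndcP.
apply: (@eq_measurable_fun _ _ _ _ _ quantile).
  move=> t; rewrite inE/= in_itv/= => /andP[t0 t1].
  by rewrite /quantile patchE mem_set//= in_itv/= t0 ltW.
apply: (measurability (@RGenOInfty.G R)) => [|/= _ [_] [r] -> <-].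
  exact: RGenOInfty.measurableE.
rewrite (_ : _ `&` _ = `]0, 1[%classic `&` `]F r, +oo[%classic).
  exact: measurableI.
apply/seteqP; split => t /= [t01]; rewrite !in_itv/= !andbT => h; split => //.
  by rewrite ltNge -quantileP// -ltNge.
by rewrite ltNge quantileP// -ltNge.
Qed.

End quantile.

Section uniform.
Context (R : realType).

Lemma unifE (A : set R) : measurable A ->
  unif R A = lebesgue_measure (A `&` `[0, 1]%classic).
Proof.
move=> mA; rewrite [LHS]/= /uniform_prob integral_uniform_pdf.
have mA1 : measurable (A `&` `[0, 1]%classic) by exact: measurableI.
rewrite (eq_integral (cst 1%E)).
  by rewrite integral_cst// mul1e.
move=> x; rewrite inE => -[_] /=; rewrite in_itv/= => x01.
by rewrite /uniform_pdf x01 subr0 invr1.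
Qed.

Lemma unif_itv0 (a : R) : 0 <= a <= 1 -> unif R `[0, a]%classic = a%:E.
Proof.
move=> /andP[a0 a1]; rewrite unifE// setIidl.
  rewrite lebesgue_measure_itv/= lte_fin.
  by case: ltgtP a0 => // [_|<-] _; rewrite ?oppr0 ?adde0 ?subr0.
by move=> x /=; rewrite !in_itv/= => /andP[-> /le_trans]; exact.
Qed.

Lemma ae_unif01 : {ae unif R, forall t : R, 0 < t < 1}.
Proof.
exists (~` `]0, 1[%classic); split.
- exact: measurableC.
- have -> : unif R (~` `]0, 1[%classic) = (1 - unif R `]0%R, 1%R[%classic)%E.
    exact: probability_setC.
  rewrite unifE// setIidl; last first.
    by move=> x /=; rewrite !in_itv/= => /andP[/ltW -> /ltW ->].
  by rewrite lebesgue_measure_itv/= lte_fin ltr01 oppr0 adde0 subee.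
- by move=> t /=; rewrite in_itv/=.
Qed.

Lemma eq_unif01 (A B : set R) : measurable A -> measurable B ->
  (forall t, 0 < t < 1 -> A t <-> B t) -> unif R A = unif R B.
Proof.
move=> mA mB AB; rewrite -[LHS]mul1e -[RHS]mul1e -!integral_cst//.
rewrite [LHS]integral_mkcond [RHS]integral_mkcond; apply: ge0_ae_eq_integral => //.
- exact: (measurable_restrictT _ mA).1.
- exact: (measurable_restrictT _ mB).1.
- by move=> t _; rewrite patchE; case: ifP.
- by move=> t _; rewrite patchE; case: ifP.
have [N [mN N0 Nt]] := ae_unif01; exists N; split => // t /= ABt; apply: Nt => t01.
apply: ABt => _; rewrite !patchE.
by congr (if _ then _ else _); apply/idP/idP; rewrite !inE => /(AB t t01).
Qed.

Lemma law_quantile (F : cumulativeBounded (0 : R) 1) A : measurable A ->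
  lebesgue_stieltjes_measure F A = unif R (quantile F @^-1` A).
Proof.
have mq : measurable_fun [set: measurableTypeR R]
  (quantile F : measurableTypeR R -> measurableTypeR R) := measurable_quantile F.
apply: (@lebesgue_stieltjes_measure_unique R F (law (unif R) mq)).
move=> _ [[a b] _ <-]; rewrite [(a, b).1]/= [(a, b).2]/=.
transitivity (unif R (quantile F @^-1` `]a, b])); last by [].
have [ab|ba] := leP a b; last first.
  rewrite set_itv_ge ?preimage_set0 ?measure0// bnd_simp -leNgt; exact: ltW.
rewrite /lebesgue_stieltjes_measure /measure_extension/=.
rewrite measurable_mu_extE/=; last exact: is_ocitv.
rewrite wlength_itv_bnd//.
rewrite (@eq_unif01 _ `]F a, F b]%classic)//.
- rewrite unifE// setIidl.
    rewrite lebesgue_measure_itv/= lte_fin -EFinB.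
    by have := cumulative_nd F ab; case: ltgtP => // ->; rewrite subrr.
  move=> x /=; rewrite !in_itv/= => /andP[ax xb].
  by rewrite (le_trans _ (ltW ax)) ?cumulative_ge0// (le_trans xb)// cumulative_le1.
- by rewrite -[X in measurable X]setTI; exact: mq.
- by move=> t t01; rewrite /= !in_itv/= !ltNge !quantileP.
Qed.

End uniform.

(** * Subvectors of a random vector with independent uniform components *)

Section product_marginals.
Context (R : realType) (n : nat) (L : probability (n.-tuple R) R)
  (nu : 'I_n -> probability (measurableTypeR R) R).
Hypothesis L_prod : is_product L nu.

Lemma is_product_tnth k A : measurable A ->
  nu k A = L [set x | A (tnth x k)].
Proof.
move=> mA; rewrite (_ : [set x | _] = rect (fun i => if i == k then A else setT)); last first.
  apply/seteqP; split => x /=; last by move/(_ k); rewrite eqxx.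
  by move=> Ax i; case: eqP => // ->.
rewrite L_prod; last by move=> i; case: ifP.
rewrite (bigD1 k)//= eqxx big1 ?mule1// => i /negbTE ->.
exact: probability_setT.
Qed.

Lemma integral_tnth k (f : R -> \bar R) : measurable_fun setT f ->
  (\int[nu k]_t f t = \int[L]_x f (tnth x k))%E.
Proof.
move=> mf; have mk : measurable_fun [set: n.-tuple R]
  (fun x => tnth x k : measurableTypeR R) := measurable_tnth k.
rewrite -(integral_law L mk mf).
apply: eq_measure_integral => A mA _; exact: is_product_tnth.
Qed.

Lemma is_product_subtuple (S : {set 'I_n}) :
  is_product (law L (@measurable_subtuple R n S)) (fun k => nu (@enum_val _ (mem S) k)).
Proof.
move=> A mA; rewrite lawE.
pose A' i := [set r | forall k, @enum_val _ (mem S) k = i -> A k r].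
have A'E k : A' (enum_val k) = A k.
  apply/seteqP; split => r /=; first exact.
  by move=> Ar j /enum_val_inj ->.
have A'T i : i \notin S -> A' i = setT.
  move=> iS; apply/seteqP; split => // r _ k ki.
  by move: iS; rewrite -ki enum_valP.
rewrite (_ : _ @^-1` _ = rect A').
  rewrite L_prod => [|i].
    rewrite (bigID (mem S))/= [X in (_ * X)%E]big1 ?mule1.
      by rewrite big_enum_val; apply: eq_bigr => k _; rewrite A'E.
    by move=> i iS; rewrite A'T// probability_setT.
  have [iS|iS] := boolP (i \in S); last by rewrite A'T.
  by rewrite -(enum_rankK_in iS iS) A'E.
apply/seteqP; split => x /= h.
  by move=> i k <-; have := h k; rewrite tnth_mktuple.
by move=> k; rewrite tnth_mktuple; exact: h.
Qed.

Lemma product_unique (L' : probability (n.-tuple R) R) B : is_product L' nu ->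
  measurable B -> L B = L' B.
Proof. by move=> L'_prod; apply: rect_unique => A mA; rewrite L_prod// L'_prod. Qed.

End product_marginals.

Section uniform_vector.
Context (R : realType) (n : nat) (L : probability (n.-tuple R) R).
Hypothesis L_prod : is_product L (fun=> unif R).

Lemma ae_unif_vector : {ae L, forall t, forall i, 0 < tnth t i < 1}.
Proof.
apply: (@filter_forall _ _ (fun i (t : n.-tuple R) => 0 < tnth t i < 1)) => i.
have [N [mN N0 Nt]] := @ae_unif01 R.
exists [set x | N (tnth x i)]; split.
- rewrite -[X in measurable X]setTI; exact: (measurable_tnth i measurableT mN).
- by rewrite -(is_product_tnth L_prod).
- by move=> t /= ht; apply: Nt.
Qed.

Lemma integral_itv01 (f : R -> \bar R) : measurable_fun setT f ->
  (\int[lebesgue_measure]_(t in `[0%R, 1%R]) f t = \int[unif R]_t f t)%E.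
Proof.
move=> mf; rewrite (@eq_measure_integral _ _ _ _ (unif R)).
  rewrite integral_mkcond; apply: ae_eq_integral => //.
    apply: (measurable_restrictT f _).1; first exact: measurable_itv.
    exact: measurable_funTS.
  have [N [mN N0 Nt]] := @ae_unif01 R; exists N; split => // t /= h; apply: Nt => t01.
  apply: h => _; rewrite patchE mem_set//= in_itv/=.
  by case/andP: t01 => /ltW -> /ltW ->.
by move=> A mA A1; rewrite -[RHS]/(unif R A) unifE// setIidl.
Qed.

Lemma integral_upd k x (f : n.-tuple R -> \bar R) : measurable_fun setT f ->
  (\int[lebesgue_measure]_(t in `[0%R, 1%R]) f (upd k t x) =
   avg L [set~ k]%SET f x)%E.
Proof.
move=> mf; have mfu : measurable_fun setT (fun t : R => f (upd k t x)).
  have mp : measurable_fun setT (fun t : R => (t, x)) by exact: measurable_fun_pair.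
  exact: (measurableT_comp mf (measurableT_comp (@measurable_upd R n k) mp)).
rewrite integral_itv01// (integral_tnth L_prod k mfu); apply: eq_integral => y _.
by rewrite (@upd_mix _ _ k _ x y erefl).
Qed.

Lemma iterated_integral_itv01 (S : {set 'I_n}) (f : #|S|.-tuple R -> \bar R) :
  measurable_fun setT f -> (forall z, 0 <= f z)%E ->
  (iterated_integral (fun=> @lebesgue_measure R) (fun=> `[0%R, 1%R]%classic) f
   <= \int[L]_x f (subtuple S x))%E.
Proof.
move=> mf f0.
rewrite (@eq_iterated_integral _ _ _ (fun=> unif R) _ _ f)//; last first.
  by move=> i A mA A1; rewrite -[RHS]/(unif R A) unifE// setIidl.
rewrite ge0_iterated_integralE//.
rewrite -(integral_law L (@measurable_subtuple R n S) mf).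
rewrite (@eq_measure_integral _ _ _ _ (law L (@measurable_subtuple R n S))).
  apply: ge0_subset_integral => //.
    by apply: measurable_rect.
move=> A mA _; apply: product_unique mA; first exact: prodm_is_product.
exact: is_product_subtuple L_prod S.
Qed.

End uniform_vector.

(** * Conditional expectations given some of the components *)

Section random_vector.
Context (R : realType) (n : nat) (d : measure_display) (T : measurableType d)
  (P : probability T R) (V : 'I_n -> {RV P >-> R}).
Implicit Types (J S : {set 'I_n}).

Lemma measurable_rv_tuple : measurable_fun setT (rv_tuple V).
Proof. by apply: measurable_tuple => i. Qed.

Lemma mix_local J k (x y z : n.-tuple R) : k \notin J ->
  mix J (mix [set~ k]%SET x y) z = mix J x z.
Proof.
move=> kJ; apply/eq_from_tnth => i; rewrite !tnth_mix !inE.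
by case: ifP => // iJ; rewrite ifT//; apply: contraNneq kJ => <-.
Qed.

Let z0 : n.-tuple R := [tuple 0 | _ < n].

(** The sigma-algebra of the [V_j], [j] in [J], consists of the preimages of the
    Borel sets under the random vector whose coordinates outside [J] are
    set to zero; this and the next lemma are the two inclusions. *)
Lemma sigma_family_preimage J B : measurable B ->
  sigma_family V J [set w | B (mix J (rv_tuple V w) z0)].
Proof.
pose f w := mix J (rv_tuple V w) z0.
have sJ : sigma_algebra setT (sigma_family V J) by exact: smallest_sigma_algebra.
suff : measurable `<=` image_set_system setT f (sigma_family V J).
  by move=> /(_ B)/[apply]; rewrite /image_set_system /= setTI.
apply: smallest_sub; first exact: sigma_algebra_image.
rewrite -bigcup_seq/=; apply: bigcup_sub => i _ _ [A mA <-].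
rewrite /image_set_system /= !setTI.
have [iJ|iJ] := boolP (i \in J).
  apply: sub_sigma_algebra; exists i => //; exists A => //.
  by apply/seteqP; split => w /=; rewrite /f tnth_mix iJ tnth_mktuple.
have [Ai|Ai] := pselect (A (tnth z0 i)).
  rewrite (_ : _ @^-1` _ = setT).
    by have [s0 sC _] := sJ; rewrite -(setD0 setT); apply: sC.
  by apply/seteqP; split => w //= _; rewrite /f tnth_mix (negbTE iJ).
rewrite (_ : _ @^-1` _ = set0); first by have [s0 _ _] := sJ.
by apply/seteqP; split => w //=; rewrite /f tnth_mix (negbTE iJ).
Qed.

Lemma preimage_sigma_family J A : sigma_family V J A ->
  exists2 B, measurable B & A = [set w | B (mix J (rv_tuple V w) z0)].
Proof.
pose f w := mix J (rv_tuple V w) z0.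
have : sigma_family V J `<=` preimage_set_system setT f measurable.
  apply: smallest_sub.
    by apply: sigma_algebra_preimage; exact: sigma_algebra_measurable.
  move=> _ [j jJ [C mC ->]]; exists [set x | C (tnth x j)].
    rewrite -[X in measurable X]setTI; exact: (measurable_tnth j measurableT mC).
  rewrite setTI; apply/seteqP; split => w /=; by rewrite /f tnth_mix jJ tnth_mktuple.
move=> /[apply] -[B mB <-]; exists B => //.
by rewrite setTI.
Qed.

Hypotheses (V_indep : mutually_independent V) (V_unif : forall i, uniform01 (V i)).

Lemma rv_is_product : is_product (law P measurable_rv_tuple) (fun=> unif R).
Proof.
move=> A mA; rewrite lawE.
rewrite (_ : _ @^-1` _ = [set w | forall i, A i (V i w)]); last first.
  by apply/seteqP; split => w /= h i; have := h i; rewrite tnth_mktuple.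
by rewrite V_indep//; apply: eq_bigr => i _; exact: V_unif.
Qed.

(** [h] depends on the [V_j], [j] in [S :\ k], alone, which gives its measurability
    at every point. Events of these [V_j] do not involve the [k]-th coordinate, so
    [centered_integral0] shows that zero has the right integrals over them. *)
Lemma centered_cond_expectation S k (g : #|S|.-tuple R -> R) : k \in S ->
  let L := law P measurable_rv_tuple in
  let gS y := (g (subtuple S y))%:E in
  measurable_fun setT g -> L.-integrable setT gS ->
  {ae L, forall x, avg L [set~ k]%SET gS x = 0%E} ->
  let h w := (\int[@lebesgue_measure R]_(t in `[0%R, 1%R])
                  (g (subtuple S (upd k t (rv_tuple V w))))%:E)%E in
  is_cond_expectation V (fun w => g (subtuple S (rv_tuple V w)))
      (S :\ k)%SET h /\
    {ae P, forall w, h w = 0%E}.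
Proof.
move=> kS L gS mg gi g0 h.
have mgS : measurable_fun setT gS := measurable_int _ gi.
have hE : h = avg L [set~ k]%SET gS \o rv_tuple V.
  by apply/funext => w; exact: (integral_upd rv_is_product k (rv_tuple V w) mgS).
have mavg : measurable_fun setT (avg L [set~ k]%SET gS) by exact: measurable_avg.
have mh : measurable_fun setT h.
  by rewrite hE; apply: (measurableT_comp mavg); exact: measurable_rv_tuple.
have h0 : {ae P, forall w, h w = 0%E} by rewrite hE; exact: ae_law_pre g0.
have avgJ x : avg L [set~ k]%SET gS (mix (S :\ k)%SET x z0) = avg L [set~ k]%SET gS x.
  apply: eq_integral => y _; rewrite /gS; congr (g _)%:E.
  apply/eq_from_tnth => j; rewrite !tnth_mktuple !inE.
  by case: eqP => //= _; rewrite enum_valP.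
have kJ : k \notin (S :\ k)%SET by rewrite !inE eqxx.
split => //; split.
- exact: (integrable_law P measurable_rv_tuple mgS).2 gi.
- apply/integrableP; split => //.
  rewrite (_ : (\int[P]_x _ = 0)%E)// ?ltry//.
  apply/(ae_eq_integral_abs _ measurableT mh).
  by move: h0; apply: filterS => w.
- move=> B mB.
  rewrite (_ : h @^-1` B = [set w | (avg L [set~ k]%SET gS @^-1` B)
      (mix (S :\ k)%SET (rv_tuple V w) z0)]).
    apply: sigma_family_preimage.
    by rewrite -[X in measurable X]setTI; exact: mavg.
  by rewrite hE; apply/seteqP; split => w /=; rewrite avgJ.
- move=> A /preimage_sigma_family[B mB ->].
  set B' := [set x | B (mix (S :\ k)%SET x z0)].
  have mB' : measurable B'.
    rewrite -[X in measurable X]setTI.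
    have mp : measurable_fun [set: n.-tuple R] (fun x => (x, z0)).
      by apply: measurable_fun_pair; [exact: measurable_id|exact: measurable_cst].
    exact: (measurableT_comp (@measurable_mix R n (S :\ k)%SET) mp).
  have -> : [set w | B (mix (S :\ k)%SET (rv_tuple V w) z0)] = rv_tuple V @^-1` B' by [].
  have mVB : measurable (rv_tuple V @^-1` B').
    by rewrite -[X in measurable X]setTI; exact: measurable_rv_tuple.
  transitivity (0%E : \bar R).
    rewrite (ae_eq_integral (cst 0%E))//; first by rewrite integral0.
      exact: measurable_funTS.
    by move: h0; apply: filterS => w ->.
  apply/esym; rewrite integral_mkcond.
  transitivity (\int[P]_w (gS \_ B') (rv_tuple V w))%E.
    by apply: eq_integral => w _; rewrite !patchE.
  rewrite -(integral_law P measurable_rv_tuple); last first.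
    apply: (measurable_restrictT _ mB').1; exact: measurable_funTS.
  rewrite -integral_mkcond.
  apply: (centered_integral0 rv_is_product (k := k)) => //.
  by move=> x y; rewrite /B' /= mix_local.
Qed.

End random_vector.

(** * Joint distribution functions and their marginals *)

Section weighted.
Context d (T : measurableType d) (R : realType) (mu : {measure set T -> \bar R}).
Variable f : T -> \bar R.
Hypotheses (mf : measurable_fun setT f) (f0 : forall x, (0 <= f x)%E).

Definition weighted (A : set T) : \bar R := (\int[mu]_(x in A) f x)%E.

Let weighted0 : weighted set0 = 0%E. Proof. exact: integral_set0. Qed.

Let weighted_ge0 A : (0 <= weighted A)%E. Proof. exact: integral_ge0. Qed.

Let weighted_sigma_additive : semi_sigma_additive weighted.
Proof. exact: semi_sigma_additive_nng_induced. Qed.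

Definition weighted_measure : {measure set T -> \bar R} :=
  HB.pack_for {measure set T -> \bar R} weighted
    (isMeasure.Build _ _ _ weighted weighted0 weighted_ge0 weighted_sigma_additive).

Hypothesis f1 : weighted_measure setT = 1%E.

Definition weighted_probability : probability T R :=
  HB.pack_for (probability T R) (Measure.sort weighted_measure)
    (Measure_isProbability.Build _ _ _ weighted_measure f1).

End weighted.

Section marginals.
Context (R : realType) (n : nat).
Implicit Types (F : n.-tuple R -> R) (Fm : 'I_n -> cumulativeBounded (0 : R) 1)
  (Q : {measure set (n.-tuple R) -> \bar R}).

Definition orthant (x : n.-tuple R) : set (n.-tuple R) :=
  [set y | forall i, tnth y i <= tnth x i].

Lemma orthantE x : orthant x = rect (fun i => `]-oo, tnth x i]%classic).
Proof.
by apply/seteqP; split => y /= h i; have := h i; rewrite /= in_itv/=.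
Qed.

Lemma measurable_orthant x : measurable (orthant x).
Proof. by rewrite orthantE; apply: measurable_rect => i. Qed.

(** Monotonicity reduces the limit to one along the integers, where it is
    continuity from below of the measure. *)
Lemma cvg_orthant_upd Q k s :
  Q (orthant (upd k s [tuple m | _ < n])) @[m --> +oo] -->
  Q [set y | tnth y k <= s].
Proof.
set phi := fun m : R => Q (orthant (upd k s [tuple m | _ < n])).
have sub m m' : m <= m' ->
    orthant (upd k s [tuple m | _ < n]) `<=` orthant (upd k s [tuple m' | _ < n]).
  move=> mm' y /= h i; have := h i; rewrite !tnth_mktuple; case: eqP => // _.
  by move/le_trans; exact.
have phi_nd : nondecreasing_fun phi.
  move=> m m' mm'; apply: le_measure; rewrite ?inE; try exact: measurable_orthant.
  exact: sub.
have phi_sup := nondecreasing_cvge phi_nd.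
have phi_seq : phi i%:R @[i --> \oo] --> ereal_sup (range phi).
  by move/cvge_pinftyP : phi_sup; apply; exact/cvgryPge/nbhs_infty_ger.
have phi_Q : phi i%:R @[i --> \oo] --> Q [set y | tnth y k <= s].
  rewrite (_ : [set y | _] = \bigcup_i orthant (upd k s [tuple i%:R | _ < n])).
    apply: nondecreasing_cvg_mu.
    - by move=> i; exact: measurable_orthant.
    - by apply: bigcup_measurable => i _; exact: measurable_orthant.
    - by move=> i j ij; apply/subsetPset; apply: sub; rewrite ler_nat.
  apply/seteqP; split => y /=.
    move=> yk; pose b := \big[Num.max/0]_(i < n) tnth y i.
    exists (Num.truncn b).+1 => // i; rewrite !tnth_mktuple; case: eqP => [->//|_].
    apply: (@le_trans _ _ b); last exact/ltW/truncnS_gt.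
    exact: le_bigmax.
  by move=> [i _ /(_ k)]; rewrite tnth_mktuple eqxx.
by rewrite -(cvg_unique _ phi_seq phi_Q).
Qed.

Lemma has_marginalsP F Fm Q : (forall x, (F x)%:E = Q (orthant x)) ->
  has_marginals F Fm <->
  forall k s, Q [set y | tnth y k <= s] = (Fm k s)%:E.
Proof.
move=> FQ; split => [FFm k s|QFm k s].
  have := @cvg_orthant_upd Q k s.
  under eq_fun do rewrite -FQ.
  move=> h; apply: (cvg_unique _ h) => //.
  by apply/cvg_EFin; [near=> m|exact: FFm].
have := @cvg_orthant_upd Q k s; rewrite QFm.
under eq_fun do rewrite -FQ.
by move/fine_cvg.
Unshelve. all: by end_near. Qed.

Lemma marginals_setT Q Fm (k : 'I_n) :
  (forall s, Q [set y | tnth y k <= s] = (Fm k s)%:E) -> Q setT = 1%E.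
Proof.
move=> QF; pose A (i : nat) := [set y : n.-tuple R | tnth y k <= i%:R].
have mA i : measurable (A i).
  rewrite -[X in measurable X]setTI.
  rewrite (_ : A i = (@tnth n R)^~ k @^-1` `]-oo, i%:R]).
    exact: (measurable_tnth k measurableT).
  by apply/seteqP; split => y /=; rewrite in_itv.
have h1 : Q (A i) @[i --> \oo] --> Q setT.
  rewrite (_ : setT = \bigcup_i A i).
    apply: nondecreasing_cvg_mu => //; first exact: bigcup_measurable.
    by move=> i j ij; apply/subsetPset => y /= /le_trans; apply; rewrite ler_nat.
  apply/seteqP; split => // y _; exists (Num.truncn (tnth y k)).+1 => //.
  exact/ltW/truncnS_gt.
suff h2 : Q (A i) @[i --> \oo] --> 1%E by exact: (cvg_unique _ h1 h2).
rewrite (_ : (fun i => Q (A i)) = (fun i => (Fm k i%:R)%:E)); last first.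
  by apply/funext => i; exact: QF.
apply/cvg_EFin; first by near=> i.
exact: (cvg_comp _ _ (@cvgr_idn R) (cumulativey (Fm k))).
Unshelve. all: by end_near. Qed.

Definition stieltjes (G : cumulativeBounded (0 : R) 1) :
  probability (measurableTypeR R) R := lebesgue_stieltjes_measure G.

(** A law on the line is determined by its values on half-lines. *)
Lemma stieltjes_marginal (Q : probability (n.-tuple R) R) Fm k A :
  (forall s, Q [set y | tnth y k <= s] = (Fm k s)%:E) -> measurable A ->
  stieltjes (Fm k) A = Q [set y | A (tnth y k)].
Proof.
move=> QF mA; have mk : measurable_fun [set: n.-tuple R]
  (fun x => tnth x k : measurableTypeR R) := measurable_tnth k.
apply: (@lebesgue_stieltjes_measure_unique R (Fm k) (law Q mk)) => //.
move=> _ [[a b] _ <-]; rewrite [(a, b).1]/= [(a, b).2]/=.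
have [ab|ba] := leP a b; last first.
  by rewrite set_itv_ge ?measure0// bnd_simp -leNgt; exact: ltW.
rewrite /lebesgue_stieltjes_measure /measure_extension/=.
rewrite measurable_mu_extE/=; last exact: is_ocitv.
rewrite wlength_itv_bnd// EFinB -!QF.
have mS s : measurable [set y : n.-tuple R | tnth y k <= s].
  rewrite -[X in measurable X]setTI.
  rewrite (_ : [set y | _] = (@tnth n R)^~ k @^-1` `]-oo, s]).
    exact: (measurable_tnth k measurableT).
  by apply/seteqP; split => y /=; rewrite in_itv.
transitivity (Q ([set y | tnth y k <= b] `\` [set y | tnth y k <= a])).
  rewrite measureD//; last by rewrite -ge0_fin_numE // fin_num_measure.
  by rewrite setIidr// => y /= /le_trans; exact.
congr (Q _); apply/seteqP; split => y /=; rewrite in_itv/= ltNge.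
  by move=> [-> /negP ->].
by move=> /andP[/negP ? ?].
Qed.

End marginals.

(** * Densities of copulas and densities with respect to the margins *)

Section quantile_vector.
Context (R : realType) (n : nat) (L : probability (n.-tuple R) R).
Hypothesis L_prod : is_product L (fun=> unif R).
Variable Fm : 'I_n -> cumulativeBounded (0 : R) 1.

Let M : probability (n.-tuple R) R := prodm (fun i => stieltjes (Fm i)).

Definition qvec (t : n.-tuple R) : n.-tuple R :=
  [tuple quantile (Fm i) (tnth t i) | i < n].

Definition box (x : n.-tuple R) : set (n.-tuple R) :=
  rect (fun i => `[0, Fm i (tnth x i)]%classic).

Lemma measurable_qvec : measurable_fun setT qvec.
Proof.
apply: measurable_tuple => i.
exact: (measurableT_comp (measurable_quantile (Fm i)) (measurable_tnth i)).
Qed.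

Lemma measurable_box x : measurable (box x).
Proof. by apply: measurable_rect => i. Qed.

Lemma measurable_pre_qvec A : measurable A -> measurable (qvec @^-1` A).
Proof. by move=> mA; rewrite -[X in measurable X]setTI; exact: measurable_qvec. Qed.

(** The quantile transform: substitution along [qvec] replaces the margins by
    uniform ones. *)
Lemma law_qvec B : measurable B -> M B = L (qvec @^-1` B).
Proof.
move=> mB; rewrite -[RHS](lawE L measurable_qvec).
apply: (product_unique (nu := fun i => stieltjes (Fm i))) mB.
  exact: prodm_is_product.
move=> A mA; rewrite lawE.
rewrite (_ : _ @^-1` _ = rect (fun i => quantile (Fm i) @^-1` A i)); last first.
  by apply/seteqP; split => t h i; have := h i; rewrite /= tnth_mktuple.
rewrite L_prod; last first.
  by move=> i; rewrite -[X in measurable X]setTI; exact: measurable_quantile.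
by apply: eq_bigr => i _; rewrite -[LHS](law_quantile (Fm i) (mA i)).
Qed.

Lemma integral_qvec D f : measurable D -> measurable_fun setT f ->
  (forall y, 0 <= f y)%E ->
  (\int[M]_(y in D) f y = \int[L]_(t in qvec @^-1` D) f (qvec t))%E.
Proof.
move=> mD mf f0; rewrite -(ge0_integral_law L measurable_qvec)//.
by apply: eq_measure_integral => A mA _; exact: law_qvec.
Qed.

Definition cdfvec (x : n.-tuple R) : n.-tuple R := [tuple Fm i (tnth x i) | i < n].

Lemma qvecK t : (forall i, 0 < tnth t i < 1) -> qvec (cdfvec (qvec t)) = qvec t.
Proof.
by move=> t01; apply/eq_from_tnth => i; rewrite !tnth_mktuple quantileK.
Qed.

Lemma cdfvec_qvec t : (forall i, continuous (Fm i : R -> R)) ->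
  (forall i, 0 < tnth t i < 1) -> cdfvec (qvec t) = t.
Proof.
by move=> Fc t01; apply/eq_from_tnth => i; rewrite !tnth_mktuple cdf_quantile.
Qed.

Lemma measurable_cdfvec : measurable_fun setT cdfvec.
Proof.
apply: measurable_tuple => i.
apply: (measurableT_comp (f := Fm i) _ (measurable_tnth i)).
by apply: nondecreasing_measurable => // x y; exact: cumulative_nd.
Qed.

Lemma ae_orthant_box : {ae L, forall t, forall x, orthant x (qvec t) <-> box x t}.
Proof.
have := ae_unif_vector L_prod; apply: filterS => t t01 x.
split => h i; have := h i; have := t01 i => /[dup] /andP[t0 t1] ti;
  rewrite /= tnth_mktuple quantileP// in_itv/=.
  by move=> ->; rewrite ltW.
by move=> /andP[].
Qed.

Lemma integral_orthant_box x f : measurable_fun setT f -> (forall y, 0 <= f y)%E ->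
  (\int[L]_(t in qvec @^-1` orthant x) f t = \int[L]_(t in box x) f t)%E.
Proof.
move=> mf f0; rewrite [LHS]integral_mkcond [RHS]integral_mkcond.
apply: ge0_ae_eq_integral => //.
- apply: (measurable_restrictT f (measurable_pre_qvec (measurable_orthant x))).1.
  exact: measurable_funTS.
- apply: (measurable_restrictT f (measurable_box x)).1.
  exact: measurable_funTS.
- by move=> t _; rewrite patchE; case: ifP.
- by move=> t _; rewrite patchE; case: ifP.
move: ae_orthant_box; apply: filterS => t /(_ x) tx _; rewrite !patchE.
by congr (if _ then _ else _); apply/idP/idP; rewrite !inE => /tx.
Qed.

Lemma iterated_integral_lebesgue_unif x f :
  iterated_integral (fun=> @lebesgue_measure R)
    (fun i => `[0%R, Fm i (tnth x i)]%classic) f =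
  iterated_integral (fun=> unif R) (fun i => `[0%R, Fm i (tnth x i)]%classic) f.
Proof.
apply: eq_iterated_integral => // i A mA A1.
rewrite -[RHS]/(unif R A) unifE// setIidl// => t /A1.
rewrite /= !in_itv/= => /andP[-> /le_trans ->//]. exact: cumulative_le1.
Qed.

Lemma ge0_copula_integral x f : measurable_fun setT f -> (forall y, 0 <= f y)%E ->
  (iterated_integral (fun=> @lebesgue_measure R)
    (fun i => `[0%R, Fm i (tnth x i)]%classic) f = \int[L]_(t in box x) f t)%E.
Proof.
move=> mf f0; rewrite iterated_integral_lebesgue_unif ge0_iterated_integralE//.
apply: eq_measure_integral => A mA _.
exact: (product_unique (@prodm_is_product _ _ _)).
Qed.

(** The integrand of the copula representation is nonnegative only almost
    everywhere; its absolute value is a genuine density. *)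
Lemma ae_ge0_copula_integral x f : measurable_fun setT f ->
  {ae L, forall y, 0 <= f y}%E ->
  (iterated_integral (fun=> @lebesgue_measure R)
    (fun i => `[0%R, Fm i (tnth x i)]%classic) f = \int[L]_(t in box x) `|f t|)%E.
Proof.
move=> mf f0.
have mf' : measurable_fun setT (fun t => `|f t|)%E by exact: measurableT_comp.
rewrite -ge0_copula_integral// !iterated_integral_lebesgue_unif.
apply: ae_eq_iterated_integral => //.
apply: (@eq_ae _ _ _ L).
  move=> A mA; exact: (product_unique L_prod (@prodm_is_product _ _ _)).
by move: f0; apply: filterS => t ft; rewrite gee0_abs.
Qed.

Lemma unif_quantile k s :
  unif R (quantile (Fm k) @^-1` `]-oo, s]%classic) = (Fm k s)%:E.
Proof.
rewrite (@eq_unif01 _ _ `[0, Fm k s]%classic)//.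
- by rewrite unif_itv0// cumulative_ge0 cumulative_le1.
- by rewrite -[X in measurable X]setTI; exact: measurable_quantile.
- move=> t t01; rewrite /= !in_itv/= quantileP//.
  by case/andP: t01 => /ltW ->.
Qed.

(** With atoms in the margins a copula density [c] need not give the density of
    [F] by substitution; the density arises from the Radon-Nikodym theorem,
    since the quantile map carries [c] times the uniform law to a law
    dominated by the product of the margins. *)
Lemma copula_density_abs_cont F (c : n.-tuple R -> R) :
  measurable_fun setT c -> (forall t, 0 <= c t) ->
  (\int[L]_t (c t)%:E = 1)%E ->
  (forall k A, measurable A ->
    (\int[L]_(t in [set t | A (tnth t k)]) (c t)%:E = unif R A)%E) ->
  (forall x, (F x)%:E = \int[L]_(t in box x) (c t)%:E)%E ->
  [/\ joint_cdf F, has_marginals F Fm & abs_cont_marginals F Fm].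
Proof.
move=> mc c0 c1 ck Fc.
have mEc : measurable_fun setT (EFin \o c) by exact/measurable_EFinP.
have Ec0 t : (0 <= (EFin \o c) t)%E by rewrite lee_fin.
pose W : probability (n.-tuple R) R := @weighted_probability _ _ _ L _ mEc Ec0 c1.
pose Q := law W measurable_qvec.
have QE B : Q B = (\int[L]_(t in qvec @^-1` B) (c t)%:E)%E by [].
have FQ x : (F x)%:E = Q (orthant x).
  by rewrite Fc QE integral_orthant_box.
split.
- by exists Q => x; rewrite FQ.
- apply/(has_marginalsP Fm FQ) => k s.
  rewrite -[LHS]/(Q [set y | tnth y k <= s]) QE -unif_quantile -(ck k).
    congr (integral _ _ _); apply/seteqP; split => t /=;
      by rewrite tnth_mktuple in_itv.
  by rewrite -[X in measurable X]setTI; exact: measurable_quantile.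
have QM : Q `<< M.
  apply/null_content_dominatesP => A mA MA0.
  rewrite QE null_set_integral//; first exact: measurable_pre_qvec.
    exact: measurable_funTS.
  exact: (etrans (esym (law_qvec mA)) MA0).
have [f [f0 ffin fi Qf]] := radon_nikodym_sigma_finite QM.
have mf := measurable_int _ fi.
exists (fine \o f); split.
- by apply: (measurableT_comp (fine_measurable measurableT)).
- by move=> x; exact: fine_ge0.
move=> x; rewrite FQ Qf; last exact: measurable_orthant.
rewrite (@ge0_iterated_integralE _ _ (fun i => stieltjes (Fm i))) => [|i||y].
- by rewrite orthantE; apply: eq_integral => y _; rewrite /= fineK.
- by [].
- by apply/measurable_EFinP; apply: (measurableT_comp (fine_measurable measurableT)).
- by rewrite lee_fin fine_ge0.
Qed.

Section density.
Variables (F : n.-tuple R -> R) (G : n.-tuple R -> R).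
Hypotheses (n_gt0 : (0 < n)%N) (FG : has_density F Fm G) (FFm : has_marginals F Fm).

Let mG : measurable_fun setT (EFin \o G).
Proof. by case: FG => mG _ _; exact/measurable_EFinP. Qed.

Let G0 x : (0 <= (EFin \o G) x)%E.
Proof. by case: FG => _ G0 _; rewrite lee_fin. Qed.

Let Q0 : {measure set (n.-tuple R) -> \bar R} := weighted_measure M mG G0.

Let FQ0 x : (F x)%:E = Q0 (orthant x).
Proof.
case: FG => _ _ ->.
by rewrite (@ge0_iterated_integralE _ _ (fun i => stieltjes (Fm i))).
Qed.

Lemma density_marginal0 k s : Q0 [set y | tnth y k <= s] = (Fm k s)%:E.
Proof. exact: (has_marginalsP Fm FQ0).1. Qed.

Lemma density_setT : Q0 setT = 1%E.
Proof.
exact: (marginals_setT (k := Ordinal n_gt0) (@density_marginal0 (Ordinal n_gt0))).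
Qed.

Let Q : probability (n.-tuple R) R := @weighted_probability _ _ _ M _ mG G0 density_setT.

Lemma density_joint_cdf : joint_cdf F.
Proof. by exists Q => x; rewrite FQ0. Qed.

Lemma density_marginal k A : measurable A ->
  (\int[M]_(y in [set y | A (tnth y k)]) (G y)%:E = stieltjes (Fm k) A)%E.
Proof.
move=> mA; apply/esym.
exact: (@stieltjes_marginal _ _ Q Fm k A (@density_marginal0 k) mA).
Qed.

Lemma density_copula x :
  ((F x)%:E = \int[L]_(t in box x) (G (qvec t))%:E)%E.
Proof.
rewrite FQ0 -integral_orthant_box//.
- exact: (integral_qvec (measurable_orthant x) mG G0).
- exact: (measurableT_comp mG measurable_qvec).
- by move=> y; exact: G0.
Qed.

Lemma density_copula1 : (\int[L]_t (G (qvec t))%:E = 1)%E.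
Proof.
rewrite -density_setT; exact/esym/(integral_qvec measurableT mG G0).
Qed.

(** The one-dimensional marginals of the copula density [G \o qvec] are uniform:
    the average [psi] of [G] over all coordinates but the [k]-th has the same
    integrals as 1 with respect to the [k]-th margin because this margin is that
    of [F], hence it is 1 almost everywhere. *)
Lemma density_avg1 k :
  {ae L, forall t, avg L [set k]%SET (fun t => (G (qvec t))%:E) t = 1%E}.
Proof.
have M_prod : is_product M (fun i => stieltjes (Fm i)) := @prodm_is_product _ _ _.
have mk : measurable_fun [set: n.-tuple R]
  (fun x => tnth x k : measurableTypeR R) := measurable_tnth k.
pose psi (r : measurableTypeR R) := avg M [set k]%SET (EFin \o G) [tuple r | _ < n].
have psiE x : psi (tnth x k) = avg M [set k]%SET (EFin \o G) x.
  apply: eq_integral => y _; congr (EFin (G _)); apply/eq_from_tnth => i.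
  by rewrite !tnth_mix tnth_mktuple inE; case: eqP => // ->.
have mpsi : measurable_fun setT psi.
  have mc : measurable_fun setT (fun r : measurableTypeR R => [tuple r | _ < n]).
    by apply: measurable_tuple => i; exact: measurable_id.
  exact: (measurableT_comp (measurable_avg M [set k]%SET mG) mc).
have psi0 r : (0 <= psi r)%E by exact: avg_ge0.
have psiA A : measurable A ->
    (\int[stieltjes (Fm k)]_(r in A) psi r = stieltjes (Fm k) A)%E.
  move=> mA; rewrite -density_marginal//.
  have mB : measurable [set y : n.-tuple R | A (tnth y k)].
    by rewrite -[X in measurable X]setTI; exact: (measurable_tnth k measurableT).
  rewrite integral_mkcond (integral_tnth M_prod k); last first.
    by apply: (measurable_restrictT psi mA).1; exact: measurable_funTS.
  rewrite [RHS]integral_mkcond -[RHS](integral_avg M_prod [set k]%SET); last 2 first.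
    by apply: (measurable_restrictT (EFin \o G) mB).1; exact: measurable_funTS.
    by move=> y; rewrite patchE; case: ifP => // _; exact: G0.
  apply: eq_integral => y _; rewrite patchE psiE /avg.
  have mixk z : tnth (mix [set k]%SET y z) k = tnth y k by rewrite tnth_mix inE eqxx.
  case: ifPn => yA.
    by apply: eq_integral => z _; rewrite patchE mem_set//= mixk; exact: set_mem.
  apply/esym/integral0_eq => z _; rewrite patchE memNset//= mixk.
  by rewrite notin_setE in yA.
have psi1 : {ae stieltjes (Fm k), forall r, psi r = 1%E}.
  have : ae_eq (stieltjes (Fm k)) setT psi (cst 1%E).
    apply: integral_ae_eq => //.
      apply/integrableP; split => //.
      under eq_integral do rewrite gee0_abs//.
      by rewrite psiA// probability_setT ltry.
    by move=> A _ mA; rewrite psiA// integral_cst// mul1e.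
  by apply: filterS => r; exact.
have {}psi1 : {ae M, forall y, avg M [set k]%SET (EFin \o G) y = 1%E}.
  have := ae_law_pre (mf := mk) (eq_ae (m2 := law M mk) _ psi1).
  move/(_ (fun A mA => is_product_tnth M_prod k mA)).
  by apply: filterS => y; rewrite psiE.
have := ae_law_pre (mf := measurable_qvec) (eq_ae (m2 := law L measurable_qvec) _ psi1).
move/(_ law_qvec); apply: filterS => t <-.
transitivity (\int[L]_y (EFin \o G) (mix [set k]%SET (qvec t) (qvec y)))%E.
  apply: eq_integral => y _; congr (EFin (G _)); apply/eq_from_tnth => i.
  by rewrite tnth_mktuple !tnth_mix !tnth_mktuple; case: ifP.
apply/esym/(@integral_qvec setT) => //.
exact: (measurableT_comp mG (measurable_mixx _ _)).
Qed.

End density.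

End quantile_vector.

(** * Canonical representations *)

Section canonical_representation.
Context (R : realType) (n : nat) (n_ge2 : (2 <= n)%N)
  (Fm : 'I_n -> cumulativeBounded (0 : R) 1)
  (d : measure_display) (T : measurableType d) (P : probability T R)
  (V : 'I_n -> {RV P >-> R})
  (V_indep : mutually_independent V) (V_unif : forall i, uniform01 (V i)).
Implicit Types (F : n.-tuple R -> R) (g : kernels R n) (S : {set 'I_n}).

Let L : probability (n.-tuple R) R := law P (measurable_rv_tuple V).

Let L_prod : is_product L (fun=> unif R) := rv_is_product V_indep V_unif.

Lemma measurable_U g : borel g -> measurable_fun setT (U g).
Proof.
move=> mg; rewrite (_ : U g = fun t =>
    \sum_(S : {set 'I_n}) (if (2 <= #|S|)%N then g S (subtuple S t) else 0)); last first.
  by apply/funext => t; rewrite UE big_mkcond.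
apply: measurable_sum => S; have [S2|//] := leqP 2 #|S|.
exact: (measurableT_comp (mg S S2) (@measurable_subtuple R n S)).
Qed.

Section sufficiency.
Variables (F : n.-tuple R -> R) (g : kernels R n).
Arguments g : clear implicits.
Hypothesis g_adm : admissible V g.

Let mg : borel g. Proof. by case: g_adm. Qed.

Let gS (S : {set 'I_n}) (t : n.-tuple R) := (g S (subtuple S t))%:E.

Let mgS S : (2 <= #|S|)%N -> measurable_fun setT (gS S).
Proof.
move=> S2; apply/measurable_EFinP.
exact: (measurableT_comp (mg S2) (@measurable_subtuple R n S)).
Qed.

Lemma admissible_integrable S : (2 <= #|S|)%N -> L.-integrable setT (gS S).
Proof.
move=> S2; have /card_gt0P[k kS] : (0 < #|S|)%N := ltnW S2.
case: g_adm => _ _ /(_ S S2 k kS)[[gi _ _ _] _] _.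
exact: (integrable_law P (measurable_rv_tuple V) (mgS S2)).1 gi.
Qed.

Lemma admissible_centered S k : (2 <= #|S|)%N -> k \in S ->
  {ae L, forall x, avg L [set~ k]%SET (gS S) x = 0%E}.
Proof.
move=> S2 kS; case: g_adm => _ _ /(_ S S2 k kS)[_ g0] _.
apply/ae_law.
  rewrite -[X in measurable X]setTI.
  exact: (measurable_avg L [set~ k]%SET (mgS S2) measurableT (emeasurable_set1 0%E)).
move: g0; apply: filterS => w <-.
by rewrite (integral_upd L_prod k _ (mgS S2)).
Qed.

Lemma admissible_ge0 : {ae L, forall t, (0 <= (1 + U g t)%:E)%E}.
Proof.
have mp : measurable [set t | 0 <= (1 + U g t)%:E]%E.
  rewrite -[X in measurable X]setTI.
  apply: emeasurable_fun_c_infty => //; apply/measurable_EFinP.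
  by apply: measurable_funD => //; exact: measurable_U.
apply: (ae_law (measurable_rv_tuple V) mp).
case: g_adm => _ _ _; apply: filterS => w.
by rewrite lee_fin -lerBlDl sub0r.
Qed.

(** [S] has an element [j] other than [k], and the event about the [k]-th
    coordinate does not involve the [j]-th. *)
Lemma integral_kernel S k A : (2 <= #|S|)%N -> measurable A ->
  (\int[L]_(t in [set t | A (tnth t k)]) gS S t = 0)%E.
Proof.
move=> S2 mA.
have [j jS jk] : exists2 j, j \in S & j != k.
  have /card_gt0P[j] : (0 < #|S :\ k|)%N.
    by rewrite -(leq_add2l (k \in S)) -cardsD1 (leq_trans _ S2)// addn1 ltnS leq_b1.
  by rewrite !inE => /andP[jk jS]; exists j.
apply: (centered_integral0 L_prod (k := j)).
- by rewrite -[X in measurable X]setTI; exact: (measurable_tnth k measurableT mA).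
- exact: admissible_integrable.
- exact: admissible_centered.
- by move=> x y; rewrite /= tnth_mix !inE eq_sym jk.
Qed.

(** The kernels integrate to zero over such events, so only the constant 1
    contributes: the weighted law has uniform marginals. *)
Lemma integral_admissible k A : measurable A ->
  (\int[L]_(t in [set t | A (tnth t k)]) `|1 + U g t|%:E = unif R A)%E.
Proof.
move=> mA; set B := [set t | _].
have mB : measurable B.
  by rewrite -[X in measurable X]setTI; exact: (measurable_tnth k measurableT mA).
pose h (S : {set 'I_n}) t := if (2 <= #|S|)%N then gS S t else 0%E.
have hi S : L.-integrable B (h S).
  apply: (integrableS measurableT) => //; rewrite /h.
  by have [S2|S2] := leqP 2 #|S|; [exact: admissible_integrable|exact: integrable0].
have UEh t : (1 + U g t)%:E = (1 + \sum_S h S t)%E.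
  rewrite EFinD UE big_mkcond/= -sumEFin; congr (_ + _)%E.
  by apply: eq_bigr => S _; rewrite /h; case: ifP.
have m1U : measurable_fun setT (fun t => (1 + U g t)%:E).
  by apply/measurable_EFinP; apply: measurable_funD => //; exact: measurable_U.
transitivity (\int[L]_(t in B) (1 + \sum_S h S t))%E.
  apply: ae_eq_integral => //.
  - apply/measurable_EFinP; apply: measurable_funTS.
    apply: measurableT_comp => //.
    by apply: measurable_funD => //; exact: measurable_U.
  - by under eq_fun do rewrite -UEh; exact: measurable_funTS.
  - move: admissible_ge0; apply: filterS => t t0 _.
    by rewrite -UEh ger0_norm// -lee_fin.
rewrite integralD//; last 2 first.
- exact: finite_measure_integrable_cst.
- exact: integrable_sum.
rewrite integral_cst// mul1e integral_sum// big1 ?adde0.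
  by rewrite (is_product_tnth L_prod k mA).
move=> S _; rewrite /h; have [S2|_] := leqP 2 #|S|; last by rewrite integral0.
exact: integral_kernel.
Qed.

Lemma admissible_abs_cont :
  (forall x, (F x)%:E = \int[L]_(t in box Fm x) `|1 + U g t|%:E)%E ->
  [/\ joint_cdf F, has_marginals F Fm & abs_cont_marginals F Fm].
Proof.
move=> Fx; apply: (copula_density_abs_cont L_prod (c := fun t => `|1 + U g t|)) => //.
- apply: measurableT_comp => //.
  by apply: measurable_funD => //; exact: measurable_U.
- have := @integral_admissible (Ordinal (ltnW n_ge2)) setT measurableT.
  by rewrite probability_setT.
- by move=> k A mA; exact: integral_admissible.
Qed.

Lemma copula_representation_abs_cont : copula_representation F Fm g ->
  [/\ joint_cdf F, has_marginals F Fm & abs_cont_marginals F Fm].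
Proof.
move=> Fg; apply: admissible_abs_cont => x; rewrite Fg.
rewrite (ae_ge0_copula_integral L_prod)//.
  by apply/measurable_EFinP; apply: measurable_funD => //; exact: measurable_U.
exact: admissible_ge0.
Qed.

(** With continuous margins [t] is recovered from its quantiles, which turns
    the density with respect to the margins back into a copula density. *)
Lemma density_representation_abs_cont :
  (forall i, continuous (Fm i : R -> R)) -> density_representation F Fm g ->
  [/\ joint_cdf F, has_marginals F Fm & abs_cont_marginals F Fm].
Proof.
move=> Fc Fg; have [mG G0 _] := Fg.
apply: admissible_abs_cont => x; rewrite (density_copula L_prod Fg).
apply: ae_eq_integral => //.
- exact: measurable_box.
- apply: measurable_funTS; apply/measurable_EFinP.
  exact: (measurableT_comp mG (measurable_qvec Fm)).
- apply: measurable_funTS; apply/measurable_EFinP.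
  apply: measurableT_comp => //.
  by apply: measurable_funD => //; exact: measurable_U.
have := ae_unif_vector L_prod; apply: filterS => t t01 _.
have := G0 (qvec Fm t).
by rewrite -/(cdfvec Fm (qvec Fm t)) cdfvec_qvec// => U0; rewrite ger0_norm.
Qed.

End sufficiency.

(** The kernels come from the Hoeffding decomposition of the copula density
    obtained by substituting the quantile functions into the density. *)
Lemma abs_cont_kernels F : has_marginals F Fm -> abs_cont_marginals F Fm ->
  exists g, [/\ admissible V g, copula_representation F Fm g &
    density_representation F Fm g].
Proof.
move=> FFm [G FG]; have [mG G0 FE] := FG.
have n0 : (0 < n)%N := ltnW n_ge2.
pose c t := G (qvec Fm t).
have mc : measurable_fun setT c by exact: (measurableT_comp mG (measurable_qvec Fm)).
have c0 t : 0 <= c t by exact: G0.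
have c1 : (\int[L]_x (c x)%:E = 1)%E by exact: (density_copula1 L_prod n0 FG FFm).
have cm j : {ae L, forall x, avg L [set j]%SET (EFin \o c) x = 1%E}.
  exact: (density_avg1 L_prod n0 FG FFm j).
pose g := hoeffding L c.
have Ug t : 1 + U g t = c t by exact: U_hoeffding.
have mgS S : measurable_fun setT (g S) by exact: measurable_hoeffding.
exists g; split.
- split.
  + by move=> S _.
  + move=> S S2.
    apply: (le_lt_trans (iterated_integral_itv01 L_prod _ _)) => //.
      apply/measurable_EFinP; by apply: measurableT_comp => //; exact: mgS.
    by have /integrableP[] := integrable_hoeffding L_prod mc c0 c1 S.
  + move=> S S2 k kS; apply: (centered_cond_expectation V_indep V_unif kS).
    * exact: mgS.
    * exact: (integrable_hoeffding L_prod mc c0 c1 S).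
    * exact: (hoeffding_centered L_prod mc c0 c1 cm kS).
  + apply: aeW => w; have := c0 (rv_tuple V w).
    by rewrite -Ug -lerBlDl sub0r.
- move=> x; rewrite (density_copula L_prod FG).
  rewrite -(ge0_copula_integral L_prod); last 2 first.
  + by apply/measurable_EFinP.
  + by move=> t; rewrite lee_fin.
  by apply: eq_iterated_integral => // t _; rewrite Ug.
- have mcF : measurable_fun setT (c \o cdfvec Fm).
    exact: (measurableT_comp mc (measurable_cdfvec Fm)).
  rewrite /density_representation.
  rewrite (_ : (fun x => _) = c \o cdfvec Fm); last first.
    by apply/funext => x; rewrite Ug.
  split => // [x|x]; first exact: c0.
  have E (h : n.-tuple R -> R) : measurable_fun setT h -> (forall x, 0 <= h x) ->
      iterated_integral (fun i => lebesgue_stieltjes_measure (Fm i))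
        (fun i => [set` `]-oo, tnth x i]]) (fun t => (h t)%:E) =
      (\int[L]_(t in qvec Fm @^-1` orthant x) (h (qvec Fm t))%:E)%E.
    move=> mh h0.
    have mEh : measurable_fun setT (EFin \o h) by exact/measurable_EFinP.
    have Eh0 t : (0 <= (EFin \o h) t)%E by rewrite lee_fin.
    rewrite -(integral_qvec L_prod Fm (measurable_orthant x) mEh Eh0) orthantE.
    by rewrite (@ge0_iterated_integralE _ _ (fun i => stieltjes (Fm i))).
  have mO := measurable_pre_qvec Fm (measurable_orthant x).
  rewrite FE !E//; last by move=> y; exact: c0.
  apply: ae_eq_integral => //.
  + by apply: measurable_funTS; exact/measurable_EFinP.
  + apply: measurable_funTS; apply/measurable_EFinP.
    exact: (measurableT_comp mcF (measurable_qvec Fm)).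
  + have := ae_unif_vector L_prod; apply: filterS => t t01 _.
    by rewrite /= /c qvecK.
Qed.

End canonical_representation.

Theorem theorem3p3 (R : realType) (n : nat) (hn : (2 <= n)%N)
    (Fm : 'I_n -> cumulativeBounded (0 : R) 1)
    (d : measure_display) (T : measurableType d) (P : probability T R)
    (V : 'I_n -> {RV P >-> R})
    (V_indep : mutually_independent V)
    (V_unif : forall i, uniform01 (V i))
    (F : n.-tuple R -> R) (F01 : forall x, 0 <= F x <= 1) :
  let abs_cont_joint_cdf :=
    [/\ joint_cdf F, has_marginals F Fm & abs_cont_marginals F Fm] in
  [/\ abs_cont_joint_cdf <->
        (exists g : kernels R n,
           admissible V g /\ copula_representation F Fm g),
      abs_cont_joint_cdf <->
        has_marginals F Fm /\
        (exists g : kernels R n,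
           admissible V g /\ density_representation F Fm g) &
      (forall i, continuous (Fm i : R -> R)) ->
      (abs_cont_joint_cdf <->
        (exists g : kernels R n,
           admissible V g /\ density_representation F Fm g))].
Proof.
move=> abs_cont_joint_cdf.
have necessity : abs_cont_joint_cdf -> exists g : kernels R n,
    [/\ admissible V g, copula_representation F Fm g &
      density_representation F Fm g].
  by move=> [_ FFm FG]; exact: abs_cont_kernels.
split.
- split=> [/necessity[g [? ? _]]|[g [g_adm Fg]]]; first by exists g.
  exact: (copula_representation_abs_cont hn V_indep V_unif g_adm Fg).
- split=> [aF|[FFm [g [_ Fg]]]].
    have [g [? _ ?]] := necessity aF; have [_ ? _] := aF.
    by split => //; exists g.
  split => //; last by exists (fun x => 1 + U g [tuple Fm i (tnth x i) | i < n]).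
  exact: (density_joint_cdf (ltnW hn) Fg FFm).
- move=> Fc; split=> [/necessity[g [? _ ?]]|[g [g_adm Fg]]]; first by exists g.
  exact: (density_representation_abs_cont hn V_indep V_unif g_adm Fc Fg).
Qed.
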